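(* For every $n\ge 1$, the map $\Psi':\mathcal{I}_n\to\mathcal{A}_n$ is a one-to-one correspondence between Stoimenow matchings with $n$ arcs and ascent sequences of length $n$.
   Context: **Matchings.** A matching of $\{1,\dots,2n\}$ is a partition of that set into blocks of size 2, called arcs. An arc is written $[a,b]$ with $a<b$; $a$ is its opener and $b$ its closer. A matching is *Stoimenow* if it has neither of the following. Type 1: a pair of arcs $[a,k+1]$, $[b,k]$ with $a<b$ (nested arcs with adjacent closers). Type 2: a pair of arcs $[k,d]$, $[k+1,c]$ with $c<d$ (nested arcs with adjacent openers). $\mathcal{I}_n$ is the set of Stoimenow matchings with $n$ arcs, i.e. on $\{1,\dots,2n\}$. A matching $\pi$ is identified with the fixed-point-free involution in which $\pi_i$ is the point paired with $i$. **Labels.** The label of an arc is the number of runs of closers (maximal sets of consecutive points that are all closers) preceding its opener; the label of an opener is the label of its arc. For $\pi\in\mathcal{I}_n$, the maximal arc is $\mathrm{maxarc}(\pi)=[\pi_{2n},2n]$ and the reduction arc is $\mathrm{redarc}(\pi)=[\pi_{1+\pi_{2n}},1+\pi_{2n}]$, i.e. the arc whose closer is the point immediately to the right of the opener of the maximal arc. Let $\mathsf{M}(\pi)$ be the label of the maximal arc and $\mathsf{m}(\pi)$ the label of the reduction arc. Let $L_i(\pi)$ be the set of arcs of $\pi$ with label $i$. **Removal operation $\psi'$.** Let $n\ge2$, $\pi\in\mathcal{I}_n$ and $i=\mathsf{m}(\pi)$. A matching $\sigma$ with $n-1$ arcs is obtained as follows (after the operations, points are renumbered $1,\dots,2n-2$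 from left to right; arcs keep their two endpoints when endpoints are moved). - (Rem1) If $|L_i(\pi)|>1$, remove the reduction arc. - (Rem2) If $|L_i(\pi)|=1$ and $i=\mathsf{M}(\pi)$, then $\mathrm{maxarc}(\pi)=\mathrm{redarc}(\pi)=[2n-1,2n]$; remove this arc. - (Rem3) If $|L_i(\pi)|=1$ and $i<\mathsf{M}(\pi)$: (a) let $A$ be the set of all closers between the opener of the reduction arc and the next opener to its right; move all points of $A$, keeping their relative order, to between the opener of the maximal arc and the closer of the reduction arc. (b) For each $0\le j<i$, partition the openers with label $j$ into three consecutive segments $X_j,Y_j,Z_j$ (from left to right), where $Y_j$ consists of the openers whose closers are in $A$; swap the segments $Y_j$ and $Z_j$, preserving their internal orders (the new order is $X_j,Z_j,Y_j$). (c) Remove the reduction arc. Put $\psi'(\pi)=(\sigma,i)$. The resulting $\sigma$ lies in $\mathcal{I}_{n-1}$. **Ascent sequences.** For a sequence of integers $x=(x_1,\dots,x_n)$, $\mathrm{asc}(x)$ is the number of positions $i$ with $x_i<x_{i+1}$. Let $$\mathcal{A}_n=\{(x_1,\dots,x_n): x_1=0 \text{ and } 0\le x_i\le 1+\mathrm{asc}(x_1,\dots,x_{i-1}) \text{ for } 1<i\le n\},$$ the set of ascent sequences of length $n$ (with integer entries). **The map $\Psi'$.** For $n=1$, $\Psi'$ sends the only element of $\mathcal{I}_1$ to $(0)$. For $n\ge2$ and $\pi\in\mathcal{I}_n$ with $\psi'(\pi)=(\sigma,i)$, $\Psi'(\pi)=(x_1,\dots,x_{n-1},i)$ where $(x_1,\dots,x_{n-1})=\Psi'(\sigma)$.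 *)

(* Defs.v *)
From mathcomp Require Import all_boot.

Set Implicit Arguments.
Unset Strict Implicit.
Unset Printing Implicit Defensive.

(* Points are numbered from 0: a matching of 2n points is the
   one-line notation p of a fixed-point-free involution of {0, ..., 2n-1}, the
   point paired with k being nth 0 p k. *)

Definition matching (n : nat) (p : seq nat) : Prop :=
  size p = n.*2 /\
  forall k, k < n.*2 ->
    [/\ nth 0 p k < n.*2, nth 0 p k != k & nth 0 p (nth 0 p k) = k].

Definition arc (p : seq nat) (a b : nat) : bool :=
  [&& a < b, b < size p & nth 0 p a == b].

Definition stoimenow (n : nat) (p : seq nat) : Prop :=
  [/\ matching n p,
      ~ (exists a b k, [/\ arc p a k.+1, arc p b k & a < b])
    & ~ (exists c d k, [/\ arc p k d, arc p k.+1 c & c < d])].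

Definition points (p : seq nat) : seq nat := iota 0 (size p).

Definition is_opener (p : seq nat) (k : nat) : bool :=
  (k < size p) && (k < nth 0 p k).

Definition is_closer (p : seq nat) (k : nat) : bool :=
  (k < size p) && (nth 0 p k < k).

Definition closer_run (p : seq nat) (a b : nat) : bool :=
  [&& a <= b, all (is_closer p) (iota a (b.+1 - a)),
      (a == 0) || ~~ is_closer p a.-1 & ~~ is_closer p b.+1].

Definition label (p : seq nat) (o : nat) : nat :=
  count (fun r => closer_run p r.1 r.2)
        [seq (a, b) | a <- iota 0 o, b <- iota 0 o].

Definition arcs (p : seq nat) : seq (nat * nat) :=
  [seq (o, nth 0 p o) | o <- points p & is_opener p o].

Definition arc_label (p : seq nat) (e : nat * nat) : nat := label p e.1.

Definition arcs_with_label (p : seq nat) (i : nat) : seq (nat * nat) :=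
  [seq e <- arcs p | arc_label p e == i].

Definition openers_with_label (p : seq nat) (j : nat) : seq nat :=
  [seq o <- points p | is_opener p o && (label p o == j)].

Definition maxarc (p : seq nat) : nat * nat :=
  (nth 0 p (size p).-1, (size p).-1).

Definition redarc (p : seq nat) : nat * nat :=
  let c := (maxarc p).1.+1 in (nth 0 p c, c).

Definition max_label (p : seq nat) : nat := arc_label p (maxarc p).
Definition red_label (p : seq nat) : nat := arc_label p (redarc p).

(* A rearrangement of a subset of the points of p, closed under p, is given by
   listing the old points in their new order; renumber p s is the matching
   obtained by renumbering the points of s from left to right. *)
Definition renumber (p s : seq nat) : seq nat :=
  [seq index (nth 0 p x) s | x <- s].

Definition remove_arc (e : nat * nat) (s : seq nat) : seq nat :=
  [seq x <- s | (x != e.1) && (x != e.2)].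

Definition next_opener (p : seq nat) (k : nat) : nat :=
  head (size p) [seq y <- points p | is_opener p y && (k < y)].

Definition moved_closers (p : seq nat) : seq nat :=
  let o := (redarc p).1 in
  [seq x <- points p | is_closer p x && (o < x < next_opener p o)].

Definition move_closers (p : seq nat) : seq nat :=
  let A := moved_closers p in
  let m := (maxarc p).1 in
  [seq x <- points p | (x \notin A) && (x <= m)] ++ A ++
  [seq x <- points p | (x \notin A) && (m < x)].

(* The openers of label j, listed in the order X_j, Z_j, Y_j. In a Stoimenow
   matching the openers of label j whose closers lie in moved_closers p are
   consecutive among the openers of label j, hence Y below consists of exactly
   these openers. *)
Definition swapped_openers (p : seq nat) (j : nat) : seq nat :=
  let s := openers_with_label p j in
  let inY := fun o => nth 0 p o \in moved_closers p in
  let X := take (find inY s) s in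
  let Y := take (count inY s) (drop (find inY s) s) in
  let Z := drop (find inY s + count inY s) s in
  X ++ Z ++ Y.

(* The point put at the place of x when Y_j and Z_j are swapped for all j < i *)
Definition swap_point (p : seq nat) (i x : nat) : nat :=
  if is_opener p x && (label p x < i) then
    nth 0 (swapped_openers p (label p x))
          (index x (openers_with_label p (label p x)))
  else x.

Definition rem3_order (p : seq nat) : seq nat :=
  remove_arc (redarc p)
    [seq swap_point p (red_label p) x | x <- move_closers p].

Definition psi (p : seq nat) : seq nat * nat :=
  let i := red_label p in
  let s :=
    if 1 < size (arcs_with_label p i) then remove_arc (redarc p) (points p)
    else if i == max_label p then remove_arc (maxarc p) (points p)
    else rem3_order p in
  (renumber p s, i).

(* n is the number of arcs of p; the value for n = 0 is irrelevant. *)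
Fixpoint Psi (n : nat) (p : seq nat) : seq nat :=
  match n with
  | 0 => [::]
  | n'.+1 =>
      if n' == 0 then [:: 0]
      else let: (q, i) := psi p in rcons (Psi n' q) i
  end.

Definition asc (x : seq nat) : nat :=
  count (fun k => nth 0 x k < nth 0 x k.+1) (iota 0 (size x).-1).

(* Entries of an ascent sequence are nonnegative integers, hence nat. The
   entry x_{k+1} is nth 0 x k, and take k x is (x_1, ..., x_k). *)
Definition ascent_sequence (n : nat) (x : seq nat) : Prop :=
  [/\ size x = n, nth 0 x 0 = 0
    & forall k, 0 < k < n -> nth 0 x k <= 1 + asc (take k x)].

(* Main.v *)
Require Import Defs.
From mathcomp Require Import all_boot zify.

(** A Stoimenow matching is a triangular matrix in disguise. Cut the points into
maximal runs of openers and maximal runs of closers; the two kinds alternate,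
with [k] runs of each, and the label of an opener is the index of its run. Let
the cell [(r, c)] hold the number of arcs from run [r] of openers to run [c] of
closers. Nonzero cells satisfy [r <= c], and no row or column is zero: this is a
Fishburn matrix. Forbidding nested arcs with adjacent openers or adjacent closers
means that the partner map increases along each run, so the order inside a run
is dictated by the runs of the partners. Hence the matrix determines the matching
([layering_inj]), and sorting the ends of arcs by their run and then by the run
of their partner realizes every Fishburn matrix ([layering_exists]).

The removal operation becomes transparent on matrices ([psiP]). The last row is
nonzero, so the maximal arc lies in the last diagonal cell and its opener is the
last opener. The closer of the reduction arc is therefore the first point of the
last run of closers, and this arc lies in the topmost nonzero cell
[(i, k.-1)] of the last column. Rem1 subtracts one from this cell. Rem2 deletes
the last row and the last column, when they contain nothing but one arc. In Rem3
the cell holds the only arc of row [i]: this row is deleted together with column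
[i], whose arcs, all in rows above [i], go to the last column, where these rows
are empty; exchanging the segments Y and Z puts the openers of these arcs at the
end of their runs, where the partners in the last run require them to be.

After Rem1 the topmost nonzero row of the last column is at least [i]. After Rem2
it is less than [i], and [i] is the new dimension; after Rem3 it is less than
[i], and [i] is less than the new dimension. So the case can be read off from the
result and [i], and the operation can be undone for every [i] between zero and
the dimension of the smaller matrix ([extend_reduce], [reduce_extend]). Moreover
the dimension drops exactly when the new top row is less than [i], that is, when
appending [i] creates an ascent; the dimension is therefore one more than the
number of ascents ([Psi_ascent]), and the range of [i] is the one allowed for
the next entry of an ascent sequence. The theorem follows by induction on the
number of arcs. *)

Set Implicit Arguments.
Unset Strict Implicit.
Unset Printing Implicit Defensive.

(** * Fishburn matrices as multisets of cells *)

(** Innermost conditionals are split first, since conditions may themselves contain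
conditionals. *)
Ltac cases_lia :=
  repeat match goal with
  | |- context [if ?b then _ else _] =>
      lazymatch b with
      | context [if _ then _ else _] => fail
      | _ => case: (boolP b) => ?
      end
  end; lia.

(** The matrix is given by the multiset of its cells, each listed as often as its
entry; a list stands for the multiset, so that lists are compared up to
permutation. *)
Definition fishburn (k : nat) (M : seq (nat * nat)) : Prop :=
  [/\ forall r c, (r, c) \in M -> r <= c < k,
      forall r, r < k -> exists c, (r, c) \in M
    & forall c, c < k -> exists r, (r, c) \in M].

(** For the cells of a matching, this is the label of the reduction arc. *)
Definition top_row (k : nat) (M : seq (nat * nat)) : nat :=
  find (fun r => (r, k.-1) \in M) (iota 0 k).

Definition row_weight (M : seq (nat * nat)) (r : nat) : nat :=
  count (fun e => e.1 == r) M.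

(** Position of a cell after the deletion of row [i], by then zero, and of column
[i], whose content joins the last column. *)
Definition contract (k i : nat) (e : nat * nat) : nat * nat :=
  (if e.1 < i then e.1 else e.1.-1,
   if e.2 == i then k.-2 else if e.2 < i then e.2 else e.2.-1).

(** Inverse of [contract]; here [k] is the smaller dimension. In the last column,
what lies above row [i] came from the deleted column, and the rest from the
former last column [k]. *)
Definition expand (k i : nat) (e : nat * nat) : nat * nat :=
  (if e.1 < i then e.1 else e.1.+1,
   if e.2 == k.-1 then (if e.1 < i then i else k)
   else if e.2 < i then e.2 else e.2.+1).

(** The removal operation on matrices. Rem1 and Rem2 share the first branch: in Rem2
the last row and column become zero, and the dimension alone records their
deletion. *)
Definition reduce (k : nat) (M : seq (nat * nat)) : seq (nat * nat) :=
  let i := top_row k M in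
  let M' := rem (i, k.-1) M in
  if (1 < row_weight M i) || (i == k.-1) then M' else map (contract k i) M'.

Definition reduce_dim (k : nat) (M : seq (nat * nat)) : nat :=
  if 1 < row_weight M (top_row k M) then k else k.-1.

(** The branches undo Rem1, Rem2 and Rem3, in this order. *)
Definition extend (k : nat) (M : seq (nat * nat)) (i : nat) : seq (nat * nat) :=
  if i <= top_row k M then (i, k.-1) :: M
  else if i == k then (k, k) :: M
  else (i, k) :: map (expand k i) M.

Definition extend_dim (k : nat) (M : seq (nat * nat)) (i : nat) : nat :=
  if i <= top_row k M then k else k.+1.

Lemma top_rowP k M : fishburn k M -> 0 < k ->
  [/\ top_row k M < k, (top_row k M, k.-1) \in M
    & forall r, (r, k.-1) \in M -> top_row k M <= r].
Proof.
case=> leM rows cols k0.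
have hasM : has (fun r => (r, k.-1) \in M) (iota 0 k).
  have [r Hr] := cols k.-1 ltac:(lia).
  by apply/hasP; exists r => //; rewrite mem_iota; have := leM _ _ Hr; lia.
have ltk : top_row k M < k by move: hasM; rewrite has_find size_iota.
split=> //; first by have := nth_find 0 hasM; rewrite nth_iota.
move=> r Hr; rewrite leqNgt; apply/negP => ltr.
by have := before_find 0 ltr; rewrite nth_iota ?Hr //; lia.
Qed.

Lemma top_row_unique k M i : fishburn k M -> 0 < k -> (i, k.-1) \in M ->
  (forall r, (r, k.-1) \in M -> i <= r) -> top_row k M = i.
Proof.
move=> F k0 Mi mini; have [_ Mt mint] := top_rowP F k0.
by have := mini _ Mt; have := mint _ Mi; lia.
Qed.

Lemma perm_fishburn k M N : perm_eq M N -> fishburn k M -> fishburn k N.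
Proof.
move=> /perm_mem E [leM rows cols]; split.
- by move=> r c; rewrite -E; apply: leM.
- by move=> r /rows[c Mc]; exists c; rewrite -E.
- by move=> c /cols[r Mr]; exists r; rewrite -E.
Qed.

Lemma perm_top_row k M N : perm_eq M N -> top_row k M = top_row k N.
Proof. by move=> /perm_mem E; apply: eq_find => r; rewrite E. Qed.

Lemma perm_row_weight M N r : perm_eq M N -> row_weight M r = row_weight N r.
Proof. by move/permP; apply. Qed.

Lemma perm_rem_mem (x : nat * nat) M N :
  perm_eq M N -> perm_eq (rem x M) (rem x N).
Proof.
move=> E; have [Mx|Mx] := boolP (x \in M); last first.
  by rewrite !rem_id // -(perm_mem E).
rewrite -(perm_cons x) -(permPl (perm_to_rem Mx)) (permPl E).
by apply: perm_to_rem; rewrite -(perm_mem E).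
Qed.

Lemma perm_reduce k M N : perm_eq M N -> perm_eq (reduce k M) (reduce k N).
Proof.
move=> E; rewrite /reduce (perm_top_row k E) (perm_row_weight _ E).
by case: ifP => _; rewrite ?perm_map //; apply: perm_rem_mem.
Qed.

Lemma perm_extend k M N i : perm_eq M N -> perm_eq (extend k M i) (extend k N i).
Proof.
move=> E; rewrite /extend (perm_top_row k E).
by case: ifP => _; [|case: ifP => _]; rewrite perm_cons ?perm_map.
Qed.

Lemma fishburn_dim k l M : fishburn k M -> fishburn l M -> k = l.
Proof.
have half a b : fishburn a M -> fishburn b M -> a <= b.
  move=> [_ _ cols] [leM _ _]; rewrite leqNgt; apply/negP => ltba.
  by have [r /leM] := cols _ ltba; lia.
by move=> Fk Fl; apply/eqP; rewrite eqn_leq !half.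
Qed.

Lemma row_weight_gt1 M r c : (r, c) \in M ->
  (1 < row_weight M r) = has (fun e => e.1 == r) (rem (r, c) M).
Proof.
move=> Me; rewrite (perm_row_weight r (perm_to_rem Me)) /row_weight /= eqxx.
by rewrite has_count; lia.
Qed.

(** * Removing and restoring an arc on matrices *)

Section Reduce.

Variables (k : nat) (M : seq (nat * nat)).
Hypotheses (FM : fishburn k M) (k0 : 0 < k).

Let i := top_row k M.
Let M' := rem (i, k.-1) M.

Lemma mem_rem_top e : (e \in M) = (e == (i, k.-1)) || (e \in M').
Proof. by have [_ Mi _] := top_rowP FM k0; rewrite (perm_mem (perm_to_rem Mi)) inE. Qed.

Lemma lone_row r c : (1 < row_weight M i) = false -> (r, c) \in M' -> r <> i.
Proof.
have [_ Mi _] := top_rowP FM k0; rewrite (row_weight_gt1 Mi) => /hasPn H Mrc.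
by have /= := H _ Mrc => /eqP.
Qed.

(** This separates column [i] from the last column after they are merged: the former
has entries only above row [i], the latter only below it. *)
Lemma lone_row_contract r c :
  (1 < row_weight M i) = false -> i != k.-1 -> (r, c) \in M' ->
  [/\ r <= c < k, r <> i & c = k.-1 -> i < r].
Proof.
move=> w ik Mrc; have [leM _ _] := FM; have [_ _ mint] := top_rowP FM k0.
have MM : (r, c) \in M by rewrite mem_rem_top Mrc orbT.
have ri := lone_row w Mrc; split=> //; first exact: leM.
by move=> ck; move: MM; rewrite ck => /mint; rewrite -/i; lia.
Qed.

(** Only row [i] and the last column lose an arc. A row [i] that becomes zero is
deleted. In Rem1 and Rem3 the last column keeps its diagonal cell, for if the arc
is taken from that cell, then the weight of its row, at least two, is
concentrated there. *)
Lemma fishburn_reduce : 1 < size M -> fishburn (reduce_dim k M) (reduce k M).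
Proof.
move=> sM; have [leM rows cols] := FM; have [ltik Mi mint] := top_rowP FM k0.
rewrite -/i in ltik Mi mint.
rewrite /reduce_dim /reduce -/i -/M'; case: ifP => /= w.
- split.
  + by move=> r c Mrc; apply: leM; rewrite mem_rem_top Mrc orbT.
  + move=> r ltr; have [->|ri] := eqVneq r i.
      by move: w; rewrite (row_weight_gt1 Mi) => /hasP[[r' c] Mc /= /eqP <-]; exists c.
    have [c] := rows r ltr; rewrite mem_rem_top => /orP[/eqP[]|]; last by exists c.
    by move/eqP: ri.
  + move=> c ltc; have [r] := cols c ltc; rewrite mem_rem_top.
    case/orP=> [/eqP[ri ck]|]; last by exists r.
    have [ik|ik] := eqVneq i k.-1.
      move: w; rewrite (row_weight_gt1 Mi) => /hasP[[r' c'] Mc /= /eqP E].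
      have : (r', c') \in M by rewrite mem_rem_top Mc orbT.
      by move/leM => le; exists r'; rewrite ck (_ : k.-1 = c') //; lia.
    have [c' Mc] := rows k.-1 ltac:(lia); have le := leM _ _ Mc.
    have {le} ck' : c' = k.-1 by lia.
    move: Mc; rewrite mem_rem_top ck' ck => /orP[/eqP[]|]; first by lia.
    by exists k.-1.
- case: (eqVneq i k.-1) => ik /=.
    have last_col r c : (r, c) \in M' -> c <> k.-1.
      move=> Mrc ck; have rk := lone_row w Mrc.
      have MM : (r, c) \in M by rewrite mem_rem_top Mrc orbT.
      have := leM _ _ MM; move: MM; rewrite ck => /mint; lia.
    split.
    + move=> r c Mrc; have := last_col _ _ Mrc.
      have : (r, c) \in M by rewrite mem_rem_top Mrc orbT.
      by move/leM; lia.
    + move=> r ltr; have [c] := rows r ltac:(lia).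
      by rewrite mem_rem_top => /orP[/eqP[]|]; [lia|exists c].
    + move=> c ltc; have [r] := cols c ltac:(lia).
      by rewrite mem_rem_top => /orP[/eqP[]|]; [lia|exists r].
  have H := lone_row_contract w ik.
  have inM' r c : (r, c) \in M -> r <> i -> (r, c) \in M'.
    by rewrite mem_rem_top => /orP[/eqP[]|].
  have im r c : (r, c) \in M' ->
     contract k i (r, c) \in map (contract k i) M' by apply: map_f.
  split.
  + move=> r c /mapP[[r' c'] /H[? ? ?] []]; rewrite /contract /=.
    by move=> -> ->; cases_lia.
    (* [r'] is the row of [M] that becomes row [r] *)
  + move=> r ltr; set r' := if r < i then r else r.+1.
    have [c' Mc] := rows r' ltac:(rewrite /r'; cases_lia).
    have r'i : r' <> i by rewrite /r'; cases_lia.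
    have := im _ _ (inM' _ _ Mc r'i).
    rewrite {1}/contract /= (_ : (if r' < i then r' else r'.-1) = r).
      by move=> ?; eexists; eassumption.
    by rewrite /r'; cases_lia.
  + move=> c ltc; have [ck|ck] := eqVneq c k.-2.
      have [r Mr] := cols k.-1 ltac:(lia).
      have [c' Mc] := rows k.-1 ltac:(lia); have le := leM _ _ Mc.
      have {le} ck' : c' = k.-1 by lia.
      have k1i : k.-1 <> i by lia.
      have := im _ _ (inM' _ _ Mc k1i).
      rewrite ck' /contract /= (_ : (k.-1 == i) = false); last by lia.
      rewrite (_ : (k.-1 < i) = false); last by lia.
      by rewrite ck => ?; eexists; eassumption.
    (* [c'] is the column of [M] that becomes column [c] *)
    set c' := if c < i then c else c.+1.
    have [r Mr] := cols c' ltac:(rewrite /c'; cases_lia).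
    have le := leM _ _ Mr.
    have [ri|ri] := eqVneq r i.
      move: Mr; rewrite mem_rem_top => /orP[/eqP[]|].
        by rewrite /c'; cases_lia.
      by case/H; lia.
    have := im _ _ (inM' _ _ Mr (elimN eqP ri)).
    rewrite /contract /= (_ : (c' == i) = false); last by rewrite /c'; cases_lia.
    rewrite (_ : (if c' < i then c' else c'.-1) = c).
      by move=> ?; eexists; eassumption.
    by rewrite /c'; cases_lia.
Qed.

(** After Rem3 the top row lies above [i], because column [i] was not zero. *)
Lemma contracted_top : (1 < row_weight M i) = false -> i != k.-1 ->
  exists2 r, r < i & (r, k.-2) \in map (contract k i) M'.
Proof.
move=> w ik; have [leM rows cols] := FM; have [ltik _ _] := top_rowP FM k0.
have [r Mr] := cols i ltik; have le := leM _ _ Mr.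
have Mr' : (r, i) \in M'.
  by move: Mr; rewrite mem_rem_top => /orP[/eqP[]|] //; rewrite -/i; lia.
have := lone_row w Mr' => ri.
exists r; first by lia.
apply/mapP; exists (r, i) => //; rewrite /contract /= eqxx.
by have -> : r < i by lia.
Qed.

(** The first conjunct ties the dimension to the number of ascents, and the second is
the bound on the entries of an ascent sequence. *)
Lemma top_row_reduce : 1 < size M ->
  reduce_dim k M + (top_row (reduce_dim k M) (reduce k M) < i) = k
  /\ i <= reduce_dim k M.
Proof.
move=> sM; have F := fishburn_reduce sM.
have [ltik Mi mint] := top_rowP FM k0; rewrite -/i in ltik Mi mint.
have M1 : 1 < k \/ 1 < row_weight M i.
  have [|k1] := ltnP 1 k; [by left|right].
  have [leM _ _] := FM; rewrite /row_weight (eq_in_count (a2 := predT)).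
    by rewrite count_predT.
  by case=> r c /leM /=; lia.
move: F; rewrite /reduce_dim /reduce -/i -/M'; case: ifP => /= w F.
  have [_ tin _] := top_rowP F k0.
  have : (top_row k M', k.-1) \in M by rewrite mem_rem_top tin orbT.
  by move/mint; lia.
have k1 : 0 < k.-1 by lia.
have [lt _ mt] := top_rowP F k1.
case: (eqVneq i k.-1) lt mt => [ik|ik] /= lt mt; first by lia.
by have [r ri /mt] := contracted_top w ik; lia.
Qed.

Lemma extend_reduce : 1 < size M -> perm_eq M (extend (reduce_dim k M) (reduce k M) i).
Proof.
move=> sM; have [] := top_row_reduce sM; have F := fishburn_reduce sM.
have [ltik Mi mint] := top_rowP FM k0; rewrite -/i in ltik Mi mint.
rewrite /extend; set t := top_row _ (reduce k M).
move: F; rewrite /reduce_dim /reduce -/i -/M'.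
case: ifP => /= w F Et Ei.
  by rewrite (_ : i <= t) ?perm_to_rem //; lia.
rewrite (_ : i <= t = false); last by lia.
case: (eqVneq i k.-1) => [ik|ik] /=; first by rewrite -ik {2}ik perm_to_rem.
rewrite -map_comp map_id_in ?perm_to_rem //.
case=> r c Mrc; have [? ? ?] := lone_row_contract w ik Mrc.
rewrite /expand /contract /=; congr pair.
  by cases_lia.
by cases_lia.
Qed.

End Reduce.

Section Extend.

Variables (k : nat) (N : seq (nat * nat)) (i : nat).
Hypotheses (FN : fishburn k N) (k0 : 0 < k) (ik : i <= k).

Lemma fishburn_extend : fishburn (extend_dim k N i) (extend k N i).
Proof.
have [leN rows cols] := FN; have [ltt Nt mint] := top_rowP FN k0.
rewrite /extend_dim /extend; case: ifP => it; last case: eqVneq => ik'.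
- split.
  + by move=> r c; rewrite inE => /orP[/eqP[-> ->]|/leN //]; lia.
  + by move=> r /rows[c Nc]; exists c; rewrite inE Nc orbT.
  + by move=> c /cols[r Nr]; exists r; rewrite inE Nr orbT.
- split.
  + by move=> r c; rewrite inE => /orP[/eqP[-> ->]|/leN]; lia.
  + move=> r; rewrite ltnS leq_eqVlt => /orP[/eqP->|/rows[c Nc]].
      by exists k; rewrite mem_head.
    by exists c; rewrite inE Nc orbT.
  + move=> c; rewrite ltnS leq_eqVlt => /orP[/eqP->|/cols[r Nr]].
      by exists k; rewrite mem_head.
    by exists r; rewrite inE Nr orbT.
- have im r c : (r, c) \in N ->
     expand k i (r, c) \in (i, k) :: map (expand k i) N.
    by move=> Nrc; rewrite inE map_f ?orbT.
  split.
  + move=> r c; rewrite inE => /orP[/eqP[-> ->]|]; first by lia.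
    case/mapP=> [[r' c'] /leN le]; rewrite /expand /= => -[-> ->].
    by cases_lia.
  + move=> r ltr; have [->|ri] := eqVneq r i; first by exists k; rewrite mem_head.
    have [c Nc] := rows (if r < i then r else r.-1) ltac:(cases_lia).
    have := im _ _ Nc; rewrite {1}/expand /=.
    set a := (X in (X, _)); have -> : a = r.
      by rewrite /a; cases_lia.
    by move=> ?; eexists; eassumption.
  + move=> c ltc; have [->|ck] := eqVneq c k; first by exists i; rewrite mem_head.
    have [ci|ci] := eqVneq c i.
      have := im _ _ Nt; rewrite /expand /= eqxx (_ : top_row k N < i); last by lia.
      by rewrite ci => ?; eexists; eassumption.
    have [r Nr] := cols (if c < i then c else c.-1) ltac:(cases_lia).
    have := im _ _ Nr; rewrite /expand /=.
    set a := (X in (_, X)); have -> : a = c.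
      by rewrite /a; cases_lia.
    by move=> ?; eexists; eassumption.
Qed.

Lemma extend_dim_gt0 : 0 < extend_dim k N i.
Proof. by rewrite /extend_dim; case: ifP. Qed.

Lemma top_row_extend : top_row (extend_dim k N i) (extend k N i) = i.
Proof.
apply: (top_row_unique fishburn_extend extend_dim_gt0); have [leN _ _] := FN.
  rewrite /extend_dim /extend; do ![case: ifP => ?]; rewrite inE; apply/orP; left => //.
  by apply/eqP; congr pair => /=; lia.
have [ltt Nt mint] := top_rowP FN k0.
move=> r; rewrite /extend_dim /extend; case: ifP => it; last case: eqVneq => ik' /=.
- by rewrite inE => /orP[/eqP[->]|/mint] //; lia.
- by rewrite inE => /orP[/eqP[->]|/leN] //; lia.
- rewrite inE => /orP[/eqP[->]|/mapP[[r' c'] /leN le]] //.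
  rewrite /expand /= => -[->].
  by cases_lia.
Qed.

Lemma reduce_extend : reduce (extend_dim k N i) (extend k N i) = N.
Proof.
have [leN rows cols] := FN; have [ltt Nt mint] := top_rowP FN k0.
rewrite /reduce top_row_extend /extend_dim /extend.
case: (boolP (i <= top_row k N)) => it /=; last case: (eqVneq i k) => ik' /=.
- rewrite /row_weight /= !eqxx (_ : 1 < _); last first.
    have [c Nc] := rows i ltac:(lia).
    by rewrite add1n ltnS -has_count; apply/hasP; exists (i, c) => //=.
  by [].
- by rewrite ik' orbT eqxx.
- rewrite /row_weight /= !eqxx orbF.
  rewrite ifF; last first.
    apply/negbTE; rewrite -leqNgt add1n ltnS leqn0 -[_ == 0]negbK -lt0n -has_count.
    apply/hasPn => _ /mapP[[r c] _ ->] /=.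
    by cases_lia.
  rewrite -map_comp map_id_in //; case=> r c Nrc.
  have le := leN _ _ Nrc.
  rewrite /expand /contract /=; congr pair.
    by cases_lia.
  by cases_lia.
Qed.

End Extend.

(** * Matchings layered into runs *)

(** The map [rho] cuts the points into [k] runs of openers, on even levels, and [k]
runs of closers, on odd levels, along which partners increase. Leaving [rho]
abstract makes it possible to carry it over to a rearrangement of the points;
that it can only be the index of the run is [layering_run]. *)
Definition layering (n k : nat) (p : seq nat) (rho : nat -> nat) : Prop :=
  [/\ matching n p,
      forall x y, x <= y -> y < n.*2 -> rho x <= rho y,
      forall x y, x < y -> y < n.*2 -> rho x = rho y -> nth 0 p x < nth 0 p y,
      forall x, x < n.*2 -> odd (rho x) = (nth 0 p x < x)
    & forall v, v < k.*2 <-> exists2 x, x < n.*2 & rho x = v].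

Definition cells_of (rho : nat -> nat) (p : seq nat) : seq (nat * nat) :=
  [seq ((rho x)./2, (rho (nth 0 p x))./2) | x <- points p & ~~ odd (rho x)].

Lemma matchingP n p x : matching n p -> x < n.*2 ->
  [/\ nth 0 p x < n.*2, nth 0 p x <> x & nth 0 p (nth 0 p x) = x].
Proof. by move=> [_ H] /H[? /eqP]. Qed.

Lemma matching_inj n p x y : matching n p -> x < n.*2 -> y < n.*2 ->
  nth 0 p x = nth 0 p y -> x = y.
Proof.
move=> mp xn yn E; have [_ _ Ex] := matchingP mp xn; have [_ _ Ey] := matchingP mp yn.
by rewrite -Ex E Ey.
Qed.

Section Layering.

Variables (n k : nat) (p : seq nat) (rho : nat -> nat).
Hypothesis L : layering n k p rho.

Lemma layering_lt x y : x < n.*2 -> y < n.*2 -> rho x < rho y -> x < y.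
Proof.
by case: L => _ mono _ _ _ xn yn; rewrite !ltnNge; apply: contra => /mono; apply.
Qed.

Lemma layering_partner x : x < n.*2 ->
  [/\ nth 0 p x < n.*2, nth 0 p (nth 0 p x) = x,
      rho x < k.*2, odd (rho (nth 0 p x)) = ~~ odd (rho x)
    & odd (rho x) = (rho (nth 0 p x) < rho x)].
Proof.
move=> xn; have [mp mono _ par im] := L.
have [pn px ppx] := matchingP mp xn.
have o1 := par _ xn; have o2 := par _ pn; rewrite ppx in o2.
have o3 : odd (rho (nth 0 p x)) = ~~ odd (rho x) by rewrite o1 o2; lia.
split=> //; first by apply/im; exists x.
have [le|lt] := leqP x (nth 0 p x).
  by have := mono _ _ le pn; lia.
by have := mono _ _ (ltnW lt) xn; lia.
Qed.

Lemma cells_ofP r c : reflect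
  (exists x, [/\ x < n.*2, rho x = r.*2 & rho (nth 0 p x) = c.*2.+1])
  ((r, c) \in cells_of rho p).
Proof.
have [[sp _] _ _ _ _] := L; apply: (iffP mapP) => [[x]|[x [xn Er Ec]]].
  rewrite mem_filter mem_iota sp add0n => /andP[ex xn] [-> ->].
  by exists x; have [_ _ _ op _] := layering_partner xn; split=> //; lia.
exists x; last by rewrite Er Ec; congr pair; lia.
by rewrite mem_filter mem_iota sp add0n xn Er; lia.
Qed.

Lemma layering_fishburn : fishburn k (cells_of rho p).
Proof.
have [_ _ _ _ im] := L; split.
- move=> r c /cells_ofP[x [xn Er Ec]].
  have [pn _ _ _] := layering_partner xn.
  by have [_ _ + _ _] := layering_partner pn; lia.
- move=> r rk; have [x xn Er] : exists2 x, x < n.*2 & rho x = r.*2.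
    by apply/im; lia.
  exists (rho (nth 0 p x))./2; apply/cells_ofP; exists x; split=> //.
  by have [_ _ _ + _] := layering_partner xn; lia.
- move=> c ck; have [x xn Ec] : exists2 x, x < n.*2 & rho x = c.*2.+1.
    by apply/im; lia.
  have [pn ppx _ + _] := layering_partner xn => op.
  exists (rho (nth 0 p x))./2; apply/cells_ofP; exists (nth 0 p x).
  by split; rewrite ?ppx //; lia.
Qed.

Lemma perm_openers_closers (E := [seq x <- points p | ~~ odd (rho x)]) :
  perm_eq (points p) (E ++ map (nth 0 p) E).
Proof.
have [mp _ _ _ _] := L; have [sp _] := mp.
have memE x : (x \in E) = ~~ odd (rho x) && (x < n.*2).
  by rewrite mem_filter mem_iota sp.
apply: uniq_perm; first exact: iota_uniq.
  have uE : uniq E by rewrite filter_uniq ?iota_uniq.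
  rewrite cat_uniq uE /=; apply/andP; split.
    apply/hasPn => _ /mapP[x + ->]; rewrite !memE => /andP[ex xn].
    by have [_ _ _ -> _] := layering_partner xn; rewrite ex.
  rewrite map_inj_in_uniq // => x y; rewrite !memE => /andP[_ xn] /andP[_ yn].
  exact: (matching_inj mp).
move=> x; rewrite mem_cat memE mem_iota sp add0n.
have [xn|xn] := ltnP x n.*2; rewrite /= ?andbT ?andbF /=.
  have [ox|//] := boolP (odd (rho x)); rewrite /=; apply/esym/mapP.
  have [pn ppx _ op _] := layering_partner xn.
  by exists (nth 0 p x); rewrite // memE op ox.
apply/esym/negbTE/mapP => -[y]; rewrite memE => /andP[_ yn] Ex.
by have [+ _ _ _ _] := layering_partner yn; lia.
Qed.

Lemma size_cells_of : size (cells_of rho p) = n.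
Proof.
have := perm_size perm_openers_closers; have [[sp _] _ _ _ _] := L.
by rewrite size_iota sp size_cat !size_map addnn => /double_inj.
Qed.

End Layering.

Definition letter (rho : nat -> nat) (p : seq nat) (x : nat) : nat * nat :=
  (rho x, rho (nth 0 p x)).

Definition leq_lex (a b : nat * nat) : bool :=
  (a.1 < b.1) || (a.1 == b.1) && (a.2 <= b.2).

Lemma perm_letters n k p rho : layering n k p rho ->
  perm_eq (map (letter rho p) (points p))
          ([seq (e.1.*2, e.2.*2.+1) | e <- cells_of rho p] ++
           [seq (e.2.*2.+1, e.1.*2) | e <- cells_of rho p]).
Proof.
move=> L; rewrite (permPl (perm_map _ (perm_openers_closers L))) map_cat.
have [[sp _] _ _ _ _] := L.
rewrite /cells_of -!map_comp; apply/permP => P; congr (count P _); congr cat.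
  apply/eq_in_map => x; rewrite mem_filter mem_iota sp add0n => /andP[ex xn].
  have [_ _ _ op _] := layering_partner L xn.
  by rewrite /letter /=; congr pair; lia.
apply/eq_in_map => x; rewrite mem_filter mem_iota sp add0n => /andP[ex xn].
have [_ ppx _ op _] := layering_partner L xn.
by rewrite /letter /= ppx; congr pair; lia.
Qed.

(** A layered matching, read from left to right, spells a lexicographically sorted
word, which is thus determined by the multiset of its letters. *)
Lemma sorted_letters n k p rho : layering n k p rho ->
  sorted leq_lex (map (letter rho p) (points p)).
Proof.
move=> L; have [[sp _] mono inc _ _] := L.
rewrite (sorted_pairwise (leT := leq_lex)); last first.
  by move=> [a b] [c d] [e f]; rewrite /leq_lex /=; lia.
rewrite pairwise_map; apply/(pairwiseP 0) => i j.
rewrite !inE size_iota => ip jp ij; rewrite !nth_iota // !add0n.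
rewrite /leq_lex /letter /=; have := mono i j (ltnW ij); rewrite -sp => /(_ jp).
rewrite leq_eqVlt => /orP[/eqP E|->] //; rewrite E eqxx ltnn /=.
have jn : j < n.*2 by lia.
have [pn _ _ _ _] := layering_partner L jn.
by have := inc i j ij jn E => /ltnW /mono; apply.
Qed.

(** Both matchings spell the same sorted word. Between the points of letter [(a, b)]
and those of letter [(b, a)], each of the two partner maps is the increasing
bijection. *)
Lemma layering_inj n k p rho l q sig :
  layering n k p rho -> layering n l q sig ->
  perm_eq (cells_of rho p) (cells_of sig q) -> p = q.
Proof.
move=> Lp Lq Epq; have [[sp mp] _ incp _ _] := Lp.
have [[sq mq] _ incq _ _] := Lq.
have points_q : points q = points p by rewrite /points sp sq.
have E : map (letter rho p) (points p) = map (letter sig q) (points p).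
  apply: (sorted_eq (leT := leq_lex)).
  - by move=> [a b] [c d] [e f]; rewrite /leq_lex /=; lia.
  - by move=> [a b] [c d]; rewrite /leq_lex /= => H; congr pair; lia.
  - exact: sorted_letters Lp.
  - by have := sorted_letters Lq; rewrite points_q.
  - rewrite (permPl (perm_letters Lp)) -{1}points_q perm_sym.
    by rewrite (permPl (perm_letters Lq)) perm_sym perm_cat // perm_map.
have mem_points x : (x \in points p) = (x < n.*2) by rewrite mem_iota sp.
have letE x : x < n.*2 -> letter rho p x = letter sig q x.
  by rewrite -mem_points; move/eq_in_map: E; apply.
(* [cls a] lists, in increasing order, the points of letter [a]. *)
pose cls a := [seq x <- points p | letter rho p x == a].
have mem_cls a x : (x \in cls a) = (letter rho p x == a) && (x < n.*2).
  by rewrite mem_filter mem_points.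
have partners r m (m' : seq nat) : layering n m m' r ->
  (forall x, x < n.*2 -> letter rho p x = letter r m' x) -> forall a,
  map (nth 0 m') (cls a) = cls (a.2, a.1).
  move=> Lm eqL a; have [_ _ incm _ _] := Lm.
  apply: (irr_sorted_eq ltn_trans ltnn).
  - rewrite (sorted_pairwise ltn_trans) pairwise_map.
    have : pairwise ltn (cls a).
      by apply: pairwise_filter; rewrite -(sorted_pairwise ltn_trans) iota_ltn_sorted.
    apply: sub_in_pairwise (allss _) => x y.
    rewrite !mem_cls => /andP[/eqP xa xn] /andP[/eqP ya yn] lt.
    apply: incm => //; move: xa; rewrite -ya !eqL // /letter; by case.
  - by apply: sorted_filter; [exact: ltn_trans | exact: iota_ltn_sorted].
  - have step x : x < n.*2 -> letter rho p (nth 0 m' x) =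
       ((letter rho p x).2, (letter rho p x).1) /\ nth 0 m' (nth 0 m' x) = x.
      move=> xn; have [pn ppx _ _ _] := layering_partner Lm xn.
      by rewrite !eqL // /letter ppx.
    move=> x; apply/mapP/idP => [[y + ->]|].
      rewrite !mem_cls => /andP[/eqP ya yn]; have [-> _] := step _ yn.
      by have [-> _ _ _ _] := layering_partner Lm yn; rewrite ya eqxx.
    rewrite mem_cls => /andP[/eqP xa xn]; have [lx ppx] := step _ xn.
    exists (nth 0 m' x) => //; have [pn _ _ _ _] := layering_partner Lm xn.
    by rewrite mem_cls lx xa pn andbT; case: (a).
apply: (@eq_from_nth _ 0); first by rewrite sp sq.
move=> x; rewrite sp => xn.
have : map (nth 0 p) (cls (letter rho p x)) = map (nth 0 q) (cls (letter rho p x)).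
  by rewrite (partners _ _ _ Lp) // (partners _ _ _ Lq).
by move/eq_in_map; apply; rewrite mem_cls eqxx.
Qed.

(** * Matchings read off sorted lists of tokens *)

(** Tokens paired by [f] are numbered by their position in [s]. With the points of a
matching as tokens this is [renumber]; with abstract ends of arcs it constructs
matchings from matrices. *)
Definition tokens_matching (T : eqType) (s : seq T) (f : T -> T) : seq nat :=
  [seq index (f x) s | x <- s].

(** By the run [v] of the token, then by the run of its partner; [u] breaks ties
between parallel arcs. *)
Definition precedes (T : Type) (f : T -> T) (v u : T -> nat) (x y : T) : bool :=
  (v x < v y) || (v x == v y) &&
  ((v (f x) < v (f y)) || (v (f x) == v (f y)) && (u x < u y)).

Definition token_cells (T : Type) (s : seq T) (f : T -> T) (v : T -> nat) :=
  [seq ((v x)./2, (v (f x))./2) | x <- s & ~~ odd (v x)].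

Section Tokens.

Variables (T : eqType) (x0 : T) (n k : nat) (s : seq T) (f : T -> T) (v u : T -> nat).

Hypotheses (size_s : size s = n.*2)
  (fs : forall x, x \in s -> f x \in s /\ f (f x) = x)
  (par : forall x, x \in s -> odd (v (f x)) = ~~ odd (v x))
  (sorted_s : pairwise (precedes f v u) s)
  (tie : forall x y, x \in s -> y \in s -> v x = v y -> v (f x) = v (f y) ->
     u x < u y -> u (f x) < u (f y))
  (F : fishburn k (token_cells s f v)).

Lemma tokens_pairwise i j : i < j -> j < n.*2 ->
  precedes f v u (nth x0 s i) (nth x0 s j).
Proof.
move=> ij jn; have /(pairwiseP x0) := sorted_s; apply; rewrite ?inE ?size_s //.
exact: ltn_trans ij jn.
Qed.

Lemma tokens_uniq : uniq s.
Proof.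
apply/(uniqP x0) => i j; rewrite !inE size_s => ilt jlt E.
have [ij|ij|//] := ltngtP i j.
  by have := tokens_pairwise ij jlt; rewrite E /precedes; lia.
by have := tokens_pairwise ij ilt; rewrite E /precedes; lia.
Qed.

Lemma tokens_index x y : x \in s -> y \in s -> precedes f v u x y ->
  index x s < index y s.
Proof.
move=> xs ys xy; rewrite ltnNge leq_eqVlt; apply/negP => /orP[/eqP E|lt].
  by have := nth_index x0 xs; rewrite -E nth_index // => E'; move: xy;
     rewrite E' /precedes; lia.
have := tokens_pairwise lt; rewrite -size_s index_mem => /(_ xs).
by rewrite !nth_index //; move: xy; rewrite /precedes; lia.
Qed.

Lemma nth_tokens_matching i : i < n.*2 ->
  nth 0 (tokens_matching s f) i = index (f (nth x0 s i)) s.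
Proof. by move=> ilt; rewrite (nth_map x0) ?size_s. Qed.

Lemma token_lt x : x \in s -> ~~ odd (v x) -> v x < v (f x).
Proof.
move=> xs ex; have [le _ _] := F.
have : ((v x)./2, (v (f x))./2) \in token_cells s f v.
  by apply/mapP; exists x; rewrite ?mem_filter ?ex.
by move/le; have := par xs; lia.
Qed.

(** Inside a run the tokens come in the order of the runs of their partners, hence in
the order of the partners themselves, provided that [u] breaks the ties between
parallel arcs in the same way at both ends. *)
Lemma tokens_layering :
  layering n k (tokens_matching s f) (fun i => v (nth x0 s i)).
Proof.
have mem i : i < n.*2 -> nth x0 s i \in s by move=> ?; rewrite mem_nth ?size_s.
split.
- split; first by rewrite size_map.
  move=> i ilt; have [fx ffx] := fs (mem i ilt).
  have lt : index (f (nth x0 s i)) s < n.*2 by rewrite -size_s index_mem.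
  rewrite !nth_tokens_matching // nth_index // ffx index_uniq ?size_s ?tokens_uniq //.
  split=> //; apply/eqP => E; have := par (mem i ilt).
  by rewrite -{1}(nth_index x0 fx) E; case: odd.
- move=> i j; rewrite leq_eqVlt => /orP[/eqP-> //|ij] jn.
  by have := tokens_pairwise ij jn; rewrite /precedes; lia.
- move=> i j ij jn E; have ilt := ltn_trans ij jn.
  rewrite !nth_tokens_matching //; set x := nth x0 s i; set y := nth x0 s j.
  have [xs ys] : x \in s /\ y \in s by rewrite !mem.
  have [[fxs ffx] [fys ffy]] := (fs xs, fs ys).
  have := tokens_pairwise ij jn; rewrite -/x -/y => xy.
  apply: tokens_index => //; move: xy; rewrite /precedes ffx ffy.
  rewrite E ltnn eqxx /= => /orP[->//|/andP[/eqP Ef lt]].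
  by rewrite Ef ltnn eqxx (tie xs ys) ?orbT.
- move=> i ilt; rewrite nth_tokens_matching //; set x := nth x0 s i.
  have xs : x \in s by apply: mem.
  have Ei : i = index x s by rewrite index_uniq ?size_s ?tokens_uniq.
  have [fxs ffx] := fs xs; rewrite [in RHS]Ei.
  have [ox|ex] := boolP (odd (v x)).
    apply/esym/tokens_index => //; rewrite /precedes.
    by have := token_lt fxs; rewrite par // ox ffx => ->.
  apply/esym/negbTE; rewrite -leqNgt ltnW //; apply: tokens_index => //.
  by rewrite /precedes token_lt.
- have [le rows cols] := F.
  have inv x : x \in s -> exists2 i, i < n.*2 & v (nth x0 s i) = v x.
    by move=> xs; exists (index x s); rewrite -?size_s ?index_mem ?nth_index.
  move=> a; split=> [ak|[i ilt <-]].
    have [oa|ea] := boolP (odd a).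
      have [r] := cols a./2 ltac:(lia); case/mapP => x.
      rewrite mem_filter => /andP[ex xs] [_ E].
      have [fxs _] := fs xs; have [i ilt Ei] := inv _ fxs.
      by exists i => //; rewrite Ei; have := par xs; lia.
    have [c] := rows a./2 ltac:(lia); case/mapP => x.
    rewrite mem_filter => /andP[ex xs] [E _].
    by have [i ilt Ei] := inv _ xs; exists i => //; lia.
  set x := nth x0 s i; have xs : x \in s by apply: mem.
  have [fxs ffx] := fs xs.
  have [ox|ex] := boolP (odd (v x)).
    have : ((v (f x))./2, (v x)./2) \in token_cells s f v.
      by apply/mapP; exists (f x); rewrite ?ffx // mem_filter par ?ox.
    by move/le; lia.
  have : ((v x)./2, (v (f x))./2) \in token_cells s f v.
    by apply/mapP; exists x; rewrite ?mem_filter ?ex.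
  by move/le; lia.
Qed.

Lemma cells_of_tokens :
  cells_of (fun i => v (nth x0 s i)) (tokens_matching s f) = token_cells s f v.
Proof.
rewrite /cells_of /token_cells /points size_map.
have Es : s = [seq nth x0 s i | i <- iota 0 (size s)].
  by rewrite -/(mkseq _ _) mkseq_nth.
rewrite [in RHS]Es filter_map -map_comp.
apply/eq_in_map => i; rewrite mem_filter mem_iota size_s add0n => /andP[_ ilt].
have xs : nth x0 s i \in s by rewrite mem_nth ?size_s.
by rewrite /= nth_tokens_matching // nth_index //; have [] := fs xs.
Qed.

End Tokens.

(** The tokens are the two ends of the listed cells, ties being broken at both ends
by the place of the cell in the list. *)
Lemma layering_exists k M : fishburn k M ->
  exists p rho, layering (size M) k p rho /\ perm_eq (cells_of rho p) M.
Proof.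
move=> FM; pose n := size M.
pose f (t : nat * bool) := (t.1, ~~ t.2).
pose v (t : nat * bool) :=
  if t.2 then (nth (0, 0) M t.1).2.*2.+1 else (nth (0, 0) M t.1).1.*2.
pose u (t : nat * bool) := t.1.
pose tokens := [seq (t, b) | t <- iota 0 n, b <- [:: false; true]].
pose le x y := ~~ precedes f v u y x.
pose s := sort le tokens.
have trans : transitive le by move=> x y z; rewrite /le /precedes; lia.
have tot : total le by move=> x y; rewrite /le /precedes; lia.
have ps : perm_eq s tokens by rewrite perm_sort.
have mem_s t b : ((t, b) \in s) = (t < n).
  rewrite (perm_mem ps); apply/allpairsP/idP => [[[t' b'] /= [tn _ [-> _]]]|tn].
    by move: tn; rewrite mem_iota.
  by exists (t, b); rewrite /= mem_iota tn; split=> //; case: b.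
have par x : odd (v (f x)) = ~~ odd (v x).
  by case: x => t [] /=; rewrite /v /= !odd_double.
have size_s : size s = n.*2.
  by rewrite size_sort size_allpairs size_iota /= muln2.
have uniq_s : uniq s.
  rewrite sort_uniq; apply: allpairs_uniq; rewrite ?iota_uniq //.
  by move=> [? ?] [? ?] _ _ [-> ->].
have sorted_s : pairwise (precedes f v u) s.
  have := sort_sorted tot tokens; rewrite (sorted_pairwise trans) -/s => H.
  have := uniq_s; rewrite uniq_pairwise => H'.
  have : pairwise (fun x y => le x y && (x != y)) s.
    by rewrite (@pairwise_relI _ le (fun x y => x != y)) H.
  apply: sub_pairwise => x y /andP[+ xy]; apply: contraR.
  move: xy; case: x y => [t b] [t' b'] ne np; rewrite /precedes -/le.
  have vE : v (t, b) = v (t', b') -> b = b'.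
    by case: b b' {ne np} => -[]; rewrite /v /=; lia.
  move: np ne; rewrite /precedes /u /=; case: (eqVneq (v (t, b)) (v (t', b'))).
    move=> /vE <-; rewrite xpair_eqE eqxx andbT; lia.
  lia.
have perm_cells : perm_eq (token_cells s f v) M.
  rewrite /token_cells (permPl (perm_map _ (perm_filter _ ps))).
  have EM : M = [seq nth (0, 0) M t | t <- iota 0 n].
    by rewrite -/(mkseq _ _) mkseq_nth.
  rewrite (_ : map _ _ = M) // [in RHS]EM /tokens.
  elim: (iota 0 n) => //= t ts IH.
  rewrite {1}/v /= odd_double /= {1}/v /= odd_double /= IH.
  by rewrite /v /=; congr cons; case: nth => r c /=; congr pair; lia.
have L := @tokens_layering _ (0, false) n k s f v u size_s.
eexists; exists (fun i => v (nth (0, false) s i)); split.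
  apply: L => //.
  - by move=> [t b]; rewrite /f /= !mem_s negbK.
  - by apply: perm_fishburn FM; rewrite perm_sym.
rewrite (@cells_of_tokens _ _ n) //; by move=> [t b]; rewrite /f /= !mem_s negbK.
Qed.

(** * Runs and labels in a Stoimenow matching *)

(** Counting the changes between openers and closers gives the index of the run of
[x] among all runs; those of openers have the even indices. *)
Definition run (p : seq nat) (x : nat) : nat :=
  count (fun y => is_closer p y != is_closer p y.+1) (iota 0 x).

Lemma iota_rcons x : iota 0 x.+1 = rcons (iota 0 x) x.
Proof. by rewrite -addn1 iotaD cats1. Qed.

Lemma runS p x : run p x.+1 = run p x + (is_closer p x != is_closer p x.+1).
Proof. by rewrite /run iota_rcons -cats1 count_cat /= addn0. Qed.

Lemma odd_run p x : odd (run p x) = is_closer p x.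
Proof.
elim: x => [|x IH]; first by rewrite /is_closer ltn0 andbF.
by rewrite runS oddD IH; do 2!case: is_closer.
Qed.

Lemma leq_run p x y : x <= y -> run p x <= run p y.
Proof.
elim: y => [|y IH]; first by rewrite leqn0 => /eqP->.
by rewrite leq_eqVlt => /orP[/eqP->|/IH] //; rewrite runS; lia.
Qed.

Lemma run_onto p y v : v <= run p y -> exists2 x, x <= y & run p x = v.
Proof.
elim: y => [|y IH]; first by rewrite leqn0 => /eqP->; exists 0.
have [/IH[x xy <-] _|lt le] := leqP v (run p y); first by exists x; lia.
by exists y.+1 => //; move: le; rewrite runS; lia.
Qed.

Lemma closer_run_unique p a a' b :
  closer_run p a b -> closer_run p a' b -> a = a'.
Proof.
have half c c' : closer_run p c b -> closer_run p c' b -> c <= c'.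
  move=> /and4P[cb _ /orP[/eqP-> //|H] _] /and4P[le /allP all' _ _].
  rewrite leqNgt; apply: contra H => lt; apply: all'.
  by rewrite mem_iota; lia.
by move=> ra ra'; apply/eqP; rewrite eqn_leq !half.
Qed.

Lemma closer_run_exists p b : is_closer p b -> ~~ is_closer p b.+1 ->
  exists a, closer_run p a b.
Proof.
move=> cb cb1.
have ex : exists a, (a <= b) && all (is_closer p) (iota a (b.+1 - a)).
  by exists b; rewrite leqnn subSnn /= cb.
case: (ex_minnP ex) => a /andP[ab all_a] mina; exists a.
rewrite /closer_run ab all_a cb1 andbT /=.
case: a ab all_a mina => [|a] //= ab all_a mina; apply/negP => ca.
suff : a < a by rewrite ltnn.
apply: mina; rewrite ltnW //= subSn ?(ltnW ab) //= ca.
by move: all_a; rewrite subSS.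
Qed.

(** A run of closers that ends before [o] is identified by its last point, a closer
followed by an opener. Such points mark every second change between openers
and closers. *)
Lemma label_run p o : is_opener p o -> label p o = (run p o)./2.
Proof.
move=> op; pose ends := [seq b <- iota 0 o | is_closer p b && ~~ is_closer p b.+1].
have -> : label p o = size ends.
  rewrite /label -size_filter -(size_map snd); apply/perm_size/uniq_perm.
  - rewrite map_inj_in_uniq; first by rewrite filter_uniq // allpairs_uniq ?iota_uniq //
      => -[? ?] [? ?] _ _ [-> ->].
    move=> [a b] [a' b']; rewrite !mem_filter /= => /andP[H _] /andP[+ _] E.
    by rewrite -E => /(closer_run_unique H) ->.
  - by rewrite filter_uniq ?iota_uniq.
  move=> b; apply/mapP/idP => [[[a b']]|].
    rewrite mem_filter => /andP[/and4P[/= le /allP ca _ cb1]].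
    case/allpairsP => -[a' b''] /= [_ b_in [_ E]] ->.
    rewrite mem_filter E b_in -E cb1 !andbT ca // mem_iota; lia.
  rewrite mem_filter mem_iota => /andP[/andP[cb cb1] bo].
  have [a ra] := closer_run_exists cb cb1; exists (a, b) => //.
  rewrite mem_filter /= ra; apply/allpairsP; exists (a, b).
  by have /and4P[le _ _ _] := ra; rewrite !mem_iota; split=> //=; lia.
have cl : is_closer p o = false.
  by move: op; rewrite /is_opener /is_closer; lia.
(* The last summand is for a run of closers that has been entered but not left. *)
have -> : run p o = (size ends).*2 + is_closer p o.
  rewrite size_filter {op cl ends}; elim: o => [|o IH].
    by rewrite /is_closer ltn0 andbF.
  rewrite runS IH iota_rcons -cats1 count_cat /=.
  by do 2!case: is_closer; lia.
by rewrite cl addn0 doubleK.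
Qed.

(** The last point is a closer, in the run of index [(dim p).*2.-1]. *)
Definition dim (p : seq nat) : nat := (run p (size p).-1)./2.+1.
Arguments dim : simpl never.
Definition cells (p : seq nat) : seq (nat * nat) := cells_of (run p) p.
Arguments cells : simpl never.

Lemma is_closerE n p x : matching n p -> x < n.*2 -> is_closer p x = (nth 0 p x < x).
Proof. by rewrite /is_closer => -[-> _] ->. Qed.

(** Two adjacent points of a run are openers or closers alike, and then the partner of
the second is the larger one, since the two arcs are not nested. *)
Lemma stoimenow_layering n p : 0 < n -> stoimenow n p ->
  layering n (dim p) p (run p).
Proof.
move=> n0 [mp no1 no2]; have [sp _] := mp.
have par x : x < n.*2 -> odd (run p x) = (nth 0 p x < x).
  by move=> xn; rewrite odd_run (is_closerE mp).
split=> //.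
- by move=> x y xy _; apply: leq_run.
- move=> x; elim=> [//|y IH] xy yn E.
  have yn' : y < n.*2 by lia.
  have le1 : run p x <= run p y by apply: leq_run.
  have le2 : run p y <= run p y.+1 by apply: leq_run.
  have Ey : run p y = run p y.+1 by lia.
  have {IH} le : nth 0 p x <= nth 0 p y.
    move: xy; rewrite ltnS leq_eqVlt => /orP[/eqP->//|xy].
    by apply/ltnW/IH => //; lia.
  apply: (leq_ltn_trans le); rewrite ltnNge; apply/negP.
  rewrite leq_eqVlt => /orP[/eqP /(matching_inj mp yn yn') | lt]; first by lia.
  have := par _ yn; have := par _ yn'; rewrite -Ey => -> parE.
  have [py ny ppy] := matchingP mp yn'; have [py1 ny1 ppy1] := matchingP mp yn.
  have [cl|op] := boolP (nth 0 p y < y).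
    apply: no1; exists (nth 0 p y.+1), (nth 0 p y), y.
    by split=> //; rewrite /Defs.arc sp ?ppy1 ?ppy eqxx; lia.
  apply: no2; exists (nth 0 p y.+1), (nth 0 p y), y.
  by split=> //; rewrite /Defs.arc sp eqxx; lia.
- have last_odd : odd (run p n.*2.-1).
    rewrite par; last by lia.
    by have [] := matchingP mp (x := n.*2.-1) ltac:(lia); lia.
  rewrite /dim sp => v; split=> [lt|[x xn <-]].
    by have [x le <-] := @run_onto p n.*2.-1 v ltac:(lia); exists x => //; lia.
  by have := @leq_run p x n.*2.-1 ltac:(lia); lia.
Qed.

(** Levels start at zero, increase by at most one at each step because none is
skipped, and their parity changes exactly when openers and closers alternate. *)
Lemma layering_run n k p rho : 0 < n -> layering n k p rho ->
  forall x, x < n.*2 -> rho x = run p x.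
Proof.
move=> n0 L; have [mp mono _ par im] := L; elim=> [|x IH] xn.
  have [y yn Ey] : exists2 y, y < n.*2 & rho y = 0.
    by apply/im; have [_ _ + _ _] := layering_partner L xn; lia.
  by have := mono 0 y (leq0n _) yn; rewrite Ey leqn0 => /eqP.
have xn' : x < n.*2 by lia.
have parx := par _ xn'; have parx1 := par _ xn.
have le : rho x <= rho x.+1 by apply: mono.
(* A larger step would skip the level just above [rho x]. *)
have le1 : rho x.+1 <= (rho x).+1.
  rewrite leqNgt; apply/negP => lt.
  have [y yn Ey] : exists2 y, y < n.*2 & rho y = (rho x).+1.
    by apply/im; have [_ _ + _ _] := layering_partner L xn; lia.
  by have [/mono|/mono] := leqP y x; [move/(_ xn')|move/(_ yn)]; lia.
by rewrite runS -IH // !(is_closerE mp) // -parx -parx1; lia.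
Qed.

Lemma layering_stoimenow n k p rho : 0 < n -> layering n k p rho ->
  [/\ stoimenow n p, dim p = k & cells p = cells_of rho p].
Proof.
move=> n0 L; have E := layering_run n0 L; have [mp mono inc par _] := L.
have [sp _] := mp.
have st : stoimenow n p.
  split=> //.
  - move=> [a [b [k' [/and3P[ak kn /eqP Ea] /and3P[bk _ /eqP Eb] ab]]]].
    rewrite sp in kn; have [an bn] : a < n.*2 /\ b < n.*2 by lia.
    have [_ _ Pa] := matchingP mp an; have [_ _ Pb] := matchingP mp bn.
    rewrite Ea in Pa; rewrite Eb in Pb.
    have k1 : k' < n.*2 by lia.
    have := inc k' k'.+1 (ltnSn _) kn; rewrite !E // runS !(is_closerE mp) //.
    by rewrite Pa Pb; lia.
  - move=> [c [d [k' [/and3P[ak kn /eqP Ea] /and3P[bk k1n /eqP Eb] ab]]]].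
    rewrite sp in kn k1n; have [k1 k2] : k' < n.*2 /\ k'.+1 < n.*2 by lia.
    have := inc k' k'.+1 (ltnSn _) k2; rewrite !E // runS !(is_closerE mp) //.
    by rewrite Ea Eb; lia.
have Ec : cells p = cells_of rho p.
  rewrite /cells /cells_of.
  rewrite (@eq_in_filter _ _ (fun x => ~~ odd (rho x))); last first.
    by move=> x; rewrite mem_iota sp add0n => xn; rewrite E.
  apply/eq_in_map => x; rewrite mem_filter mem_iota sp add0n => /andP[_ xn].
  by have [pn _ _ _ _] := layering_partner L xn; rewrite !E.
split=> //; have := layering_fishburn (stoimenow_layering n0 st).
by rewrite -/(cells p) Ec => /fishburn_dim; apply; apply: layering_fishburn L.
Qed.

(** * The removal operation in terms of runs *)

Lemma head_filter_iota d n P y (h := head d (filter P (iota 0 n))) :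
  y < n -> P y -> [/\ h < n, P h & h <= y].
Proof.
move=> yn Py; have : y \in filter P (iota 0 n) by rewrite mem_filter Py mem_iota.
have : sorted ltn (filter P (iota 0 n)).
  by apply: sorted_filter; [exact: ltn_trans | exact: iota_ltn_sorted].
have : {subset filter P (iota 0 n) <= [pred x | (x < n) && P x]}.
  by move=> x; rewrite mem_filter mem_iota inE add0n andbC.
rewrite {}/h; case: (filter _ _) => // h t /(_ h (mem_head _ _)) /andP[hn Ph] /=.
rewrite (path_sortedE ltn_trans) inE => /andP[/allP all_t _] /orP[/eqP->|/all_t] //.
by move/ltnW.
Qed.

(** In a list sorted by [w], the elements of value [v] are consecutive, so that moving
this segment to the end amounts to a stable partition. The left-hand side is the
arrangement X, Z, Y of [swapped_openers]. *)
Lemma rotate_level (T : Type) (w : T -> nat) (v : nat) (s : seq T)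
  (a := fun x => w x == v) :
  sorted (fun x y => w x <= w y) s ->
  take (find a s) s ++ drop (find a s + count a s) s ++
    take (count a s) (drop (find a s) s)
  = [seq x <- s | w x != v] ++ [seq x <- s | w x == v].
Proof.
have tr : transitive (fun x y => w x <= w y) by move=> x y z; apply: leq_trans.
rewrite (sorted_pairwise tr) {tr}.
have prefix t : all (fun x => v <= w x) t -> pairwise (fun x y => w x <= w y) t ->
  drop (count a t) t = [seq x <- t | w x != v] /\
  take (count a t) t = [seq x <- t | w x == v].
  elim: t => //= x t IH /andP[vx vt] /andP[xt pt]; rewrite /a -/a.
  have [E|ne] := eqVneq (w x) v; first by have [<- <-] := IH vt pt.
  have lt y : v < w y -> (w y == v) = false by move=> ?; lia.
  have all_gt : all (fun y => v < w y) t.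
    by apply: sub_all xt => y; lia.
  have E0 : [seq y <- t | w y == v] = [::].
    rewrite -(filter_pred0 t); elim: t all_gt {xt vt pt IH} => //= y t IH.
    by case/andP => /lt-> /IH->.
  have -> : count a t = 0 by rewrite -size_filter E0.
  rewrite E0 drop0 take0; split=> //; congr cons.
  by elim: t all_gt {xt vt pt IH E0} => //= y t IH /andP[/lt-> /IH<-].
elim: s => //= x s IH /andP[xs ps]; have ax : a x = (w x == v) by [].
rewrite !{}ax.
have [E|ne] := eqVneq (w x) v; last by rewrite /= add0n -IH.
have [|<- <-] := @prefix s _ ps; first by apply: sub_all xs => y; rewrite E.
by rewrite /= add0n.
Qed.

(** Effect of Rem3 on the indices of runs: the run [i.*2] of the reduction opener
disappears, and the run of closers that follows it joins the last one. *)
Definition contract_run (k i a : nat) : nat :=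
  if a < i.*2 then a else if a == i.*2.+1 then k.-1.*2.-1 else a.-2.

(** Orders the runs as they appear in [move_closers]: [i.*2.+1] comes just before the
last run. Doubling the indices makes room for it. *)
Definition moved_rank (k i a : nat) : nat :=
  if a == i.*2.+1 then k.*2.-1.*2.-1 else a.*2.

(** Once run [i.*2.+1] is moved, [contract_run] is nondecreasing along the list of
points and identifies this run with the last one only. *)
Lemma contract_rank k i a b : i < k.-1 -> a < k.*2 -> b < k.*2 ->
  a <> i.*2 -> b <> i.*2 -> moved_rank k i a < moved_rank k i b ->
  contract_run k i a < contract_run k i b \/
  [/\ a = i.*2.+1, b = k.*2.-1 & contract_run k i a = contract_run k i b].
Proof.
move=> ik ak bk ai bi; rewrite /moved_rank.
case: (eqVneq a i.*2.+1) => [Ea|na]; case: (eqVneq b i.*2.+1) => [Eb|nb] lt;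
  try lia; rewrite /contract_run.
- have [Ek|nk] := eqVneq b k.*2.-1; last by left; cases_lia.
  by right; split=> //; cases_lia.
- by left; cases_lia.
- by left; cases_lia.
Qed.

Lemma contract_lt k i a b : i < k.-1 -> b < k.*2 -> a < b ->
  a <> i.*2 -> a <> i.*2.+1 -> b <> i.*2 -> contract_run k i a < contract_run k i b.
Proof. by move=> *; rewrite /contract_run; cases_lia. Qed.

Lemma contract_lt_moved k i a : i < k.-1 -> a < k.*2.-1 ->
  a <> i.*2 -> a <> i.*2.+1 -> contract_run k i a < contract_run k i i.*2.+1.
Proof. by move=> *; rewrite /contract_run; cases_lia. Qed.

Lemma odd_contract k i a : i < k.-1 -> a <> i.*2 -> odd (contract_run k i a) = odd a.
Proof. by move=> *; rewrite /contract_run; cases_lia. Qed.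

Lemma contract_moved_lt k i a b : i < k.-1 -> a < i.*2 -> i.*2.+1 < b ->
  contract_run k i a < contract_run k i b.
Proof. by move=> *; rewrite /contract_run; cases_lia. Qed.

Lemma contract_eq k i a b : i < k.-1 -> a < k.*2 -> b < k.*2 ->
  a <> i.*2 -> b <> i.*2 -> contract_run k i a = contract_run k i b ->
  [\/ a = b, a = i.*2.+1 /\ b = k.*2.-1 | a = k.*2.-1 /\ b = i.*2.+1].
Proof.
move=> ik ak bk ai bi.
have [->|ne] := eqVneq a b; first by constructor 1.
have [Ea|na] := eqVneq a i.*2.+1.
  have [Eb|nb] := eqVneq b k.*2.-1; first by constructor 2.
  by rewrite /contract_run; cases_lia.
have [Eb|nb] := eqVneq b i.*2.+1.
  have [Ea|nk] := eqVneq a k.*2.-1; first by constructor 3.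
  by rewrite /contract_run; cases_lia.
by rewrite /contract_run; cases_lia.
Qed.

Lemma contract_run_half k i a b : i < k.-1 -> a <> i.*2 -> ~~ odd a -> odd b ->
  ((contract_run k i a)./2, (contract_run k i b)./2) = contract k i (a./2, b./2).
Proof.
move=> *; rewrite /contract_run /contract /=; congr pair; cases_lia.
Qed.

Section PsiStep.

Variables (n : nat) (p : seq nat).
Hypotheses (n1 : 1 < n) (st : stoimenow n p).

Let rho := run p.
Let k := dim p.
Let M := cells p.
Let i := top_row k M.
Let m := (maxarc p).1.
Let o := (redarc p).1.
Let c := (redarc p).2.

Let L : layering n k p rho.
Proof. by apply: stoimenow_layering => //; lia. Qed.

Let sp : size p = n.*2.
Proof. by case: st => -[]. Qed.

Let FM : fishburn k M := layering_fishburn L.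

Let k0 : 0 < k. Proof. by []. Qed.

Lemma mem_points_lt x : (x \in points p) = (x < n.*2).
Proof. by rewrite mem_iota sp. Qed.

Lemma is_openerE x : is_opener p x = (x < n.*2) && ~~ odd (rho x).
Proof.
rewrite /is_opener sp; case: (ltnP x n.*2) => //= xn.
have [mp _ _ -> //] := L; have [_ ne _] := matchingP mp xn; lia.
Qed.

Lemma in_cells x : x < n.*2 -> ~~ odd (rho x) ->
  ((rho x)./2, (rho (nth 0 p x))./2) \in M.
Proof.
by move=> xn ex; apply/mapP; exists x; rewrite ?mem_filter ?mem_points_lt ?xn ?ex.
Qed.

(** Partners increase along the last run of closers, so that the opener matched with
the last point is the last opener of all. *)
Lemma last_run_after_maxarc x : x < n.*2 -> (m < x) = (rho x == k.*2.-1).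
Proof.
have [mp mono inc par im] := L.
have last_n : n.*2.-1 < n.*2 by lia.
have [pn ppx rk _ _] := layering_partner L last_n.
have Em : m = nth 0 p n.*2.-1 by rewrite /m /maxarc sp.
have last_odd : odd (rho n.*2.-1).
  by rewrite par //; have [_ + _] := matchingP mp last_n; lia.
rewrite -Em in pn ppx.
have em : ~~ odd (rho m).
  by have [_ _ _ + _] := layering_partner L last_n; rewrite -Em last_odd => ->.
(* An opener of the last run of openers is matched with the last run of closers,
   along which openers increase up to [m]. *)
have top_run y : y < n.*2 -> k.*2.-2 <= rho y -> ~~ odd (rho y) -> y <= m.
  move=> yn yk ey; have [pyn ppy pyk oy lty] := layering_partner L yn.
  have [pyn' _ pyk' _ _] := layering_partner L pyn.
  have [->//|ym] := eqVneq y m.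
  have ne : nth 0 p y != n.*2.-1.
    by apply: contra ym => /eqP E; rewrite -ppy E -Em.
  have := mono (nth 0 p y) n.*2.-1 ltac:(lia) last_n.
  have := inc (nth 0 p y) n.*2.-1 ltac:(lia) last_n.
  rewrite ppy -Em; lia.
have [y yn Ey] : exists2 y, y < n.*2 & rho y = k.*2.-2.
  by apply/im; move: k0; lia.
have ym : y <= m by apply: top_run => //; rewrite Ey; move: k0; lia.
move=> xn; have [_ _ xk _ _] := layering_partner L xn.
apply/idP/eqP => [mx|Ex].
  have le1 := mono _ _ ym pn; have le2 := mono _ _ (ltnW mx) xn.
  have : odd (rho x) by apply: contraTT mx => ex; rewrite -leqNgt top_run //; lia.
  by lia.
apply: (layering_lt L) => //.
by have [_ _ mk _ _] := layering_partner L pn; lia.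
Qed.

Lemma maxarc_opener : [/\ m < n.*2, rho m = k.*2.-2 & nth 0 p m = n.*2.-1].
Proof.
have [mp mono inc par im] := L.
have last_n : n.*2.-1 < n.*2 by lia.
have [pn ppx _ opp _] := layering_partner L last_n.
have Em : m = nth 0 p n.*2.-1 by rewrite /m /maxarc sp.
rewrite -Em in pn ppx opp; split=> //.
have [_ _ mk _ _] := layering_partner L pn.
have odd_last : odd (rho n.*2.-1).
  by rewrite par //; have [_ + _] := matchingP mp last_n; lia.
have [y yn Ey] : exists2 y, y < n.*2 & rho y = k.*2.-2.
  by apply/im; move: k0; lia.
have : (m < y) = false by rewrite last_run_after_maxarc // Ey; apply/eqP; move: k0; lia.
by move/negbT; rewrite -leqNgt => /mono/(_ pn); lia.
Qed.

Lemma redarcP :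
  [/\ c = m.+1, c < n.*2, o < n.*2, nth 0 p c = o & nth 0 p o = c].
Proof.
have [mn Em Epm] := maxarc_opener; have [mp _ _ _ _] := L.
have [pmn ne ppm] := matchingP mp mn.
have Ec : c = m.+1 by [].
have cn : c < n.*2.
  have [_ _ _ _] := layering_partner L mn; rewrite Em.
  have := last_run_after_maxarc pmn; rewrite {1}Epm => + lt.
  by have [_ _ _ + _] := layering_partner L mn;
     have [_ _ + _ _] := layering_partner L pmn; rewrite Em => *; rewrite Ec; lia.
have [on _ ppc] := matchingP mp cn.
by split.
Qed.

Lemma red_closer_run : rho c = k.*2.-1.
Proof.
have [Ec cn _ _ _] := redarcP; apply/eqP.
by rewrite -last_run_after_maxarc // Ec.
Qed.

(** The closer of the reduction arc is the first point of the last run of closers.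
Since partners increase along this run, the opener lies in the topmost nonzero
row of the last column. *)
Lemma red_opener_run : rho o = i.*2.
Proof.
have [Ec cn on pc po] := redarcP; have Rc := red_closer_run.
have [_ mono inc _ _] := L.
have eo : ~~ odd (rho o).
  by have [_ _ _ + _] := layering_partner L cn; rewrite pc; lia.
rewrite (_ : i = (rho o)./2); first by lia.
apply: top_row_unique => //.
  by have := in_cells on eo; rewrite po Rc (_ : k.*2.-1./2 = k.-1) //; lia.
move=> r /(cells_ofP L)[x [xn Er Ek]].
have [pn ppx _ _ _] := layering_partner L xn.
have : m < nth 0 p x by rewrite last_run_after_maxarc // Ek; move: k0; lia.
rewrite -Ec leq_eqVlt => /orP[/eqP E|lt].
  by have := pc; rewrite E ppx => <-; lia.
have := inc _ _ lt pn; rewrite pc ppx => /(_ ltac:(rewrite Rc Ek; move: k0; lia)).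
by move/ltnW/mono/(_ xn); lia.
Qed.

Lemma red_labelE : red_label p = i.
Proof.
have [Ec cn on pc po] := redarcP.
rewrite /red_label /arc_label -/o label_run ?is_openerE ?on -/rho ?red_opener_run.
  by rewrite doubleK.
by rewrite odd_double.
Qed.

Lemma max_labelE : max_label p = k.-1.
Proof.
have [mn Em _] := maxarc_opener.
rewrite /max_label /arc_label -/m label_run ?is_openerE ?mn -/rho Em.
  by move: k0; lia.
by move: k0; lia.
Qed.

Lemma size_arcs_with_label : size (arcs_with_label p i) = row_weight M i.
Proof.
rewrite /arcs_with_label size_filter /arcs /row_weight /M /cells /cells_of.
rewrite !count_map !count_filter; apply: eq_in_count => x.
rewrite mem_points_lt => xn /=; rewrite is_openerE xn /= /arc_label /=.
by case: (boolP (odd _)) => ox; rewrite ?andbF // label_run ?is_openerE ?xn.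
Qed.

Definition kept : seq nat := [seq x <- points p | (x != o) && (x != c)].

Lemma mem_kept x : (x \in kept) = [&& x != o, x != c & x < n.*2].
Proof. by rewrite mem_filter mem_points_lt andbA. Qed.

Lemma kept_partner x : x \in kept -> nth 0 p x \in kept /\ nth 0 p (nth 0 p x) = x.
Proof.
have [_ cn on pc po] := redarcP.
rewrite !mem_kept => /and3P[xo xc xn]; have [pn ppx _ _ _] := layering_partner L xn.
split=> //; rewrite pn andbT; apply/andP; split.
  by apply: contra xc => /eqP E; rewrite -ppx E po.
by apply: contra xo => /eqP E; rewrite -ppx E pc.
Qed.

Lemma perm_kept : perm_eq (points p) (o :: c :: kept).
Proof.
have [Ec cn on pc po] := redarcP; have [mp _ _ _ _] := L.
have oc : o != c by have [_ /eqP + _] := matchingP mp cn; rewrite pc.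
apply: uniq_perm; first exact: iota_uniq.
  rewrite /= inE negb_or oc !mem_kept !eqxx andbF /= filter_uniq //.
  exact: iota_uniq.
move=> x; rewrite !inE mem_kept mem_points_lt.
by have [->|] := eqVneq x o; [|have [->|] := eqVneq x c].
Qed.

Lemma cells_kept s : perm_eq s kept ->
  perm_eq (token_cells s (nth 0 p) rho) (rem (i, k.-1) M).
Proof.
move=> ps; have [_ Mi _] := top_rowP FM k0; have [_ _ _ pc po] := redarcP.
have ro : odd (rho o) = false by rewrite red_opener_run odd_double.
have rc : odd (rho c) by rewrite red_closer_run; move: k0; lia.
have Eo : ((rho o)./2, (rho (nth 0 p o))./2) = (i, k.-1).
  by rewrite po red_opener_run red_closer_run doubleK; congr pair; lia.
have Ekept : [seq x <- o :: c :: kept | ~~ odd (rho x)] =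
    o :: [seq x <- kept | ~~ odd (rho x)] by rewrite /= ro rc.
rewrite -(perm_cons (i, k.-1)) -(permPr (perm_to_rem Mi)) -/i.
rewrite /M /cells /cells_of (permPr (perm_map _ (perm_filter _ perm_kept))).
by rewrite Ekept map_cons Eo perm_cons perm_map // perm_filter.
Qed.

Lemma lone_red_opener x : (1 < row_weight M i) = false ->
  x < n.*2 -> rho x = i.*2 -> x = o.
Proof.
move=> w xn Ex; apply/eqP; apply: contraT => xo.
have xk : x \in kept.
  rewrite mem_kept xo xn andbT; apply/eqP => E.
  by move: Ex; rewrite E red_closer_run; move: k0; lia.
have : (i, (rho (nth 0 p x))./2) \in rem (i, k.-1) M.
  rewrite -(perm_mem (cells_kept (perm_refl _))); apply/mapP; exists x.
    by rewrite mem_filter xk Ex odd_double.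
  by rewrite Ex doubleK.
by move/(lone_row FM k0 w).
Qed.

(** What the three cases of the removal operation have in common: if [g] maps runs of
[p] to runs of the new matching and the remaining points are listed in the order
that these require, then only the multiset of cells has to be compared. The
injectivity condition makes the points with equal new letters parallel in
[p]. *)
Lemma renumber_step (g : nat -> nat) s : perm_eq s kept ->
  (forall x, x \in kept -> odd (g (rho x)) = odd (rho x)) ->
  pairwise (precedes (nth 0 p) (g \o rho) id) s ->
  (forall x y, x \in kept -> y \in kept -> g (rho x) = g (rho y) ->
     g (rho (nth 0 p x)) = g (rho (nth 0 p y)) -> rho x = rho y) ->
  perm_eq (token_cells s (nth 0 p) (g \o rho)) (reduce k M) ->
  [/\ stoimenow n.-1 (renumber p s), dim (renumber p s) = reduce_dim k M
    & perm_eq (cells (renumber p s)) (reduce k M)].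
Proof.
move=> ps par sorted_s inj cells_s; have [_ _ inc _ _] := L.
have size_s : size s = n.-1.*2.
  by rewrite (perm_size ps); have := perm_size perm_kept; rewrite size_iota sp /=; lia.
have in_s x : (x \in s) = (x \in kept) by exact: perm_mem.
have fs x : x \in s -> nth 0 p x \in s /\ nth 0 p (nth 0 p x) = x.
  by rewrite !in_s; apply: kept_partner.
have F : fishburn (reduce_dim k M) (token_cells s (nth 0 p) (g \o rho)).
  apply: perm_fishburn (fishburn_reduce FM k0 _); first by rewrite perm_sym.
  by rewrite (size_cells_of L).
have par_s x : x \in s -> odd ((g \o rho) (nth 0 p x)) = ~~ odd ((g \o rho) x).
  move=> xs; have [pxs _] := fs _ xs; move: xs pxs; rewrite !in_s /= => xk pxk.
  rewrite !par //; have [] := layering_partner L (x := x) => //.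
  by move: xk; rewrite mem_kept => /and3P[].
have T : layering n.-1 (reduce_dim k M) (renumber p s) (fun j => g (rho (nth 0 s j))).
  apply: (@tokens_layering _ 0 n.-1 (reduce_dim k M) s (nth 0 p) (g \o rho) id) => //.
  move=> x y; rewrite !in_s => xk yk E1 E2 lt.
  apply: inc => //; first by move: yk; rewrite mem_kept => /and3P[].
  exact: inj.
have [//|st' dim' cells'] := layering_stoimenow _ T; first by lia.
split=> //; rewrite cells'.
by rewrite (@cells_of_tokens _ 0 n.-1 s (nth 0 p) (g \o rho)).
Qed.

(** Removing an arc from a layered matching leaves the points in the right order. *)
Lemma step_simple : (1 < row_weight M i) || (i == k.-1) ->
  [/\ stoimenow n.-1 (renumber p kept), dim (renumber p kept) = reduce_dim k M
    & perm_eq (cells (renumber p kept)) (reduce k M)].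
Proof.
move=> w; apply: (@renumber_step id) => //.
  have [_ mono inc _ _] := L.
  have : pairwise ltn kept.
    by apply: pairwise_filter; rewrite -(sorted_pairwise ltn_trans) iota_ltn_sorted.
  apply: sub_in_pairwise (allss _) => x y; rewrite !mem_kept.
  move=> /and3P[_ _ xn] /and3P[_ _ yn] lt.
  have := mono _ _ (ltnW lt) yn; rewrite /precedes /= leq_eqVlt => /orP[/eqP E|->//].
  have [pn _ _ _ _] := layering_partner L yn.
  have := mono _ _ (ltnW (inc _ _ lt yn E)) pn; rewrite E; lia.
by rewrite (permPl (cells_kept (perm_refl _))) /reduce -/i w.
Qed.

Lemma maxarc_redarc : (1 < row_weight M i) = false -> i = k.-1 -> maxarc p = redarc p.
Proof.
move=> w ik; have [mn Em Epm] := maxarc_opener; have [Ec _ _ pc po] := redarcP.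
have mo : m = o by apply: lone_red_opener => //; rewrite Em ik; move: k0; lia.
rewrite [maxarc p]surjective_pairing [redarc p]surjective_pairing -/m -/o -/c mo.
by congr pair; rewrite -po -mo Epm /= sp.
Qed.

Section Rem3.

Hypotheses (lone : (1 < row_weight M i) = false) (ik : i != k.-1).

Let g := contract_run k i.

Lemma lt_ik : i < k.-1.
Proof. by have [lt _ _] := top_rowP FM k0; rewrite -/i in lt; lia. Qed.

(** The last three facts express that column [i] lies above row [i] and that the last
column, once the reduction arc is removed, lies below it. *)
Lemma kept_levels x : x \in kept ->
  [/\ rho x < k.*2, rho x <> i.*2,
      rho x = i.*2.+1 -> rho (nth 0 p x) < i.*2,
      rho x = k.*2.-1 -> i.*2.+1 < rho (nth 0 p x)
    & rho x < i.*2 -> rho (nth 0 p x) < k.*2.-1].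
Proof.
move=> xk; have [pxk ppx] := kept_partner xk; have ltik := lt_ik.
have [_ _ mint] := top_rowP FM k0; rewrite -/M -/i in mint.
move: (xk) (pxk); rewrite !mem_kept => /and3P[xo _ xn] /and3P[po _ pn].
have [_ _ xlt op lt] := layering_partner L xn.
have [_ _ plt _ ltp] := layering_partner L pn.
have xi : rho x <> i.*2 by move/(lone_red_opener lone xn) => E; rewrite E eqxx in xo.
have pi : rho (nth 0 p x) <> i.*2.
  by move/(lone_red_opener lone pn) => E; rewrite E eqxx in po.
split=> // [E|E|lti].
- by lia.
- have : ((rho (nth 0 p x))./2, k.-1) \in M.
    apply/(cells_ofP L); exists (nth 0 p x); rewrite ppx pn E; split=> //; lia.
  by move/mint; lia.
- have [E|] := eqVneq (rho (nth 0 p x)) k.*2.-1; last by lia.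
  have : ((rho x)./2, k.-1) \in M.
    by apply/(cells_ofP L); exists x; rewrite xn E; split=> //; lia.
  by move/mint; lia.
Qed.

(** The opener of the reduction arc is alone in its run, so the closers up to the
next opener form the whole next run. *)
Lemma moved_closersE x : x < n.*2 -> (x \in moved_closers p) = (rho x == i.*2.+1).
Proof.
move=> xn; have ltik := lt_ik; have [_ mono _ _ im] := L.
have [_ _ on _ _] := redarcP; have Ro := red_opener_run.
have [y yn Ey] : exists2 y, y < n.*2 & rho y = i.*2.+2 by apply/im; lia.
have oy : o < y by apply: (layering_lt L) => //; lia.
have [] := @head_filter_iota (size p) (size p) (fun y => is_opener p y && (o < y)) y.
- by rewrite sp.
- by rewrite is_openerE yn Ey oy andbT; lia.
rewrite /moved_closers mem_filter mem_points_lt xn andbT -/o /next_opener /points.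
set y0 := head _ _; rewrite is_openerE => _ /andP[/andP[y0n ey0] oy0] y0y.
rewrite -odd_run -/rho.
apply/and3P/eqP => [[ox lto ltx]|Ex].
  have := mono _ _ (ltnW lto) xn; have := mono _ _ (ltnW (leq_trans ltx y0y)) yn; lia.
split; first by rewrite Ex; lia.
  by apply: (layering_lt L) => //; lia.
apply: (layering_lt L) => //.
have := mono _ _ (ltnW oy0) y0n; rewrite Ro leq_eqVlt => /orP[/eqP E|]; last by lia.
by have := lone_red_opener lone y0n (esym E); lia.
Qed.

Lemma move_closersE : move_closers p =
  [seq x <- points p | (rho x != i.*2.+1) && (rho x != k.*2.-1)] ++
  [seq x <- points p | rho x == i.*2.+1] ++
  [seq x <- points p | (rho x != i.*2.+1) && (rho x == k.*2.-1)].
Proof.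
rewrite /move_closers -/m; congr (_ ++ (_ ++ _)).
- apply: eq_in_filter => x; rewrite mem_points_lt => xn.
  by rewrite moved_closersE // leqNgt last_run_after_maxarc.
- rewrite -[LHS]filter_predT; rewrite {1}/moved_closers -filter_predI.
  apply: eq_in_filter => x; rewrite mem_points_lt => xn /=.
  rewrite -moved_closersE // mem_filter mem_points_lt xn andbT.
  by [].
- apply: eq_in_filter => x; rewrite mem_points_lt => xn.
  by rewrite moved_closersE // last_run_after_maxarc.
Qed.

Lemma perm_move_closers : perm_eq (move_closers p) (points p).
Proof.
have split3 (a b P : pred nat) s :
    count (predI P (fun x => ~~ a x && ~~ b x)) s +
    (count (predI P a) s + count (predI P (fun x => ~~ a x && b x)) s) = count P s.
  by elim: s => //= x s <-; case: (a x); case: (b x); case: (P x) => /=; lia.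
rewrite move_closersE; apply/permP => P; rewrite !count_cat !count_filter.
exact: (split3 (fun x => rho x == i.*2.+1) (fun x => rho x == k.*2.-1)).
Qed.

Lemma openers_with_labelE j :
  openers_with_label p j = [seq x <- points p | rho x == j.*2].
Proof.
apply: eq_in_filter => x; rewrite mem_points_lt => xn; rewrite is_openerE xn /=.
have [ox|ex] := boolP (odd (rho x)); first by apply/esym/negbTE/eqP; lia.
by rewrite label_run ?is_openerE ?xn //= -/rho; lia.
Qed.

Lemma swapped_openersE j : swapped_openers p j =
  [seq x <- openers_with_label p j | rho (nth 0 p x) != i.*2.+1] ++
  [seq x <- openers_with_label p j | rho (nth 0 p x) == i.*2.+1].
Proof.
have [_ mono inc _ _] := L.
rewrite -(rotate_level (w := fun x => rho (nth 0 p x))).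
  have E : {in openers_with_label p j, (fun x => nth 0 p x \in moved_closers p)
    =1 (fun x => rho (nth 0 p x) == i.*2.+1)}.
    move=> x; rewrite mem_filter mem_points_lt => /andP[_ xn].
    by rewrite moved_closersE //; have [] := layering_partner L xn.
  by rewrite /swapped_openers (eq_in_find E) (eq_in_count E).
rewrite openers_with_labelE sorted_pairwise; last by move=> x y z; apply: leq_trans.
have : pairwise ltn [seq x <- points p | rho x == j.*2].
  by apply: pairwise_filter; rewrite -(sorted_pairwise ltn_trans) iota_ltn_sorted.
apply: sub_in_pairwise (allss _) => x y; rewrite !mem_filter !mem_points_lt.
move=> /andP[/eqP xj xn] /andP[/eqP yj yn] lt.
have [pn _ _ _ _] := layering_partner L yn.
by apply: mono => //; apply/ltnW/inc; rewrite // xj.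
Qed.

Lemma perm_swapped_openers j :
  perm_eq (swapped_openers p j) (openers_with_label p j).
Proof.
by rewrite swapped_openersE perm_catC; apply/permPl/perm_filterC.
Qed.

Let sigma := swap_point p i.

Lemma swap_point_id x :
  ~~ ((rho x < i.*2) && ~~ odd (rho x)) -> x < n.*2 -> sigma x = x.
Proof.
move=> H xn; rewrite /sigma /swap_point is_openerE xn /=.
have [//|ex /=] := boolP (odd (rho x)).
rewrite label_run ?is_openerE ?xn // -/rho; case: ltnP => // lt.
by move: H; rewrite ex andbT; lia.
Qed.

Lemma swap_point_nth x j : rho x = j.*2 -> j < i -> x < n.*2 ->
  sigma x = nth 0 (swapped_openers p j) (index x (openers_with_label p j)).
Proof.
move=> E ji xn; rewrite /sigma /swap_point is_openerE xn E odd_double /=.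
rewrite label_run ?is_openerE ?xn -/rho E ?odd_double // doubleK ji //.
Qed.

Lemma mem_openers_with_label j x :
  (x \in openers_with_label p j) = (rho x == j.*2) && (x < n.*2).
Proof. by rewrite openers_with_labelE mem_filter mem_points_lt. Qed.

Lemma uniq_openers_with_label j : uniq (openers_with_label p j).
Proof. by rewrite filter_uniq ?iota_uniq. Qed.

Lemma swap_point_run x : x < n.*2 -> sigma x < n.*2 /\ rho (sigma x) = rho x.
Proof.
move=> xn; have [/andP[lt ex]|H] := boolP ((rho x < i.*2) && ~~ odd (rho x)).
  have E : rho x = (rho x)./2.*2 by lia.
  rewrite (swap_point_nth E) //; last by lia.
  set j := (rho x)./2 in E *.
  have : nth 0 (swapped_openers p j) (index x (openers_with_label p j))
      \in swapped_openers p j.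
    rewrite mem_nth // (perm_size (perm_swapped_openers j)) index_mem.
    by rewrite mem_openers_with_label E eqxx.
  rewrite (perm_mem (perm_swapped_openers j)) mem_openers_with_label.
  by case/andP => /eqP -> ->.
by rewrite swap_point_id.
Qed.

Lemma swap_point_inj : {in points p &, injective sigma}.
Proof.
move=> x y; rewrite !mem_points_lt => xn yn E.
have [_ Rx] := swap_point_run xn; have [_ Ry] := swap_point_run yn.
have Rxy : rho x = rho y by rewrite -Rx -Ry E.
have [/andP[lt ex]|H] := boolP ((rho x < i.*2) && ~~ odd (rho x)); last first.
  by move: E; rewrite !swap_point_id // -Rxy.
have Ex : rho x = (rho x)./2.*2 by lia.
set j := (rho x)./2 in Ex; have ji : j < i by rewrite /j; lia.
move: E; rewrite !(@swap_point_nth _ j) // -?Rxy //.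
have xj : x \in openers_with_label p j by rewrite mem_openers_with_label Ex eqxx.
have yj : y \in openers_with_label p j.
  by rewrite mem_openers_with_label -Rxy Ex eqxx.
move/eqP; rewrite nth_uniq ?(perm_size (perm_swapped_openers j)) ?index_mem //.
  by move/eqP => E; rewrite -(nth_index 0 xj) E nth_index.
by rewrite (perm_uniq (perm_swapped_openers j)) uniq_openers_with_label.
Qed.

Lemma rem3_orderE : rem3_order p =
  [seq x <- [seq sigma x | x <- move_closers p] | (x != o) && (x != c)].
Proof. by rewrite /rem3_order red_labelE. Qed.

Lemma perm_rem3_order : perm_eq (rem3_order p) kept.
Proof.
rewrite rem3_orderE /kept perm_filter //.
rewrite (permPl (perm_map _ perm_move_closers)).
have u : uniq [seq sigma x | x <- points p].
  by rewrite map_inj_in_uniq ?iota_uniq //; exact: swap_point_inj.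
have sub : {subset [seq sigma x | x <- points p] <= points p}.
  by move=> _ /mapP[x + ->]; rewrite !mem_points_lt => /swap_point_run[].
apply: uniq_perm; rewrite ?iota_uniq //.
by have [] := uniq_min_size u sub; rewrite ?size_map.
Qed.

Lemma contract_odd x : x \in kept -> odd (g (rho x)) = odd (rho x).
Proof.
by move=> /kept_levels[_ ? _ _ _]; apply: odd_contract => //; apply: lt_ik.
Qed.

Let ord := moved_rank k i.

Lemma moved_order : pairwise (fun x y =>
  (ord (rho x) < ord (rho y)) || (rho x == rho y) && (x < y)) (move_closers p).
Proof.
have ltik := lt_ik; have [_ mono _ _ _] := L.
have block (P : pred nat) :
  (forall x y, x < n.*2 -> y < n.*2 -> P x -> P y ->
     rho x < rho y -> ord (rho x) < ord (rho y)) ->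
  pairwise (fun x y => (ord (rho x) < ord (rho y)) || (rho x == rho y) && (x < y))
    [seq x <- points p | P x].
  move=> H; have : pairwise ltn [seq x <- points p | P x].
    by apply: pairwise_filter; rewrite -(sorted_pairwise ltn_trans) iota_ltn_sorted.
  apply: sub_in_pairwise (allss _) => x y; rewrite !mem_filter !mem_points_lt.
  move=> /andP[Px xn] /andP[Py yn] lt; have := mono _ _ (ltnW lt) yn.
  rewrite leq_eqVlt => /orP[/eqP->|lt'].
    by rewrite eqxx (lt : x < y) orbT.
  by rewrite H.
have bound x : x < n.*2 -> rho x < k.*2.
  by move=> xn; have [_ _ ? _ _] := layering_partner L xn.
rewrite move_closersE !pairwise_cat; apply/and3P; split.
- apply/allrelP => x y; rewrite mem_cat !mem_filter !mem_points_lt.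
  move=> /andP[xP /bound xb] yP; apply/orP; left; rewrite /ord /moved_rank.
  by case/orP: yP => /andP[yP /bound yb]; cases_lia.
- apply: block => x y /bound xb /bound yb xP yP lt.
  by rewrite /ord /moved_rank; cases_lia.
apply/and3P; split.
- apply/allrelP => x y; rewrite !mem_filter !mem_points_lt.
  move=> /andP[xP /bound xb] /andP[yP /bound yb]; apply/orP; left.
  rewrite /ord /moved_rank.
  by cases_lia.
- apply: block => x y /bound xb /bound yb xP yP lt.
  by rewrite /ord /moved_rank; cases_lia.
- apply: block => x y /bound xb /bound yb xP yP lt.
  by rewrite /ord /moved_rank; cases_lia.
Qed.

Let prec := precedes (nth 0 p) (g \o rho) id.

(** The partners in run [i.*2.+1] now belong to the last run, so their openers must
come last among the openers of label [j]. *)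
Lemma swapped_order j : j < i -> pairwise prec (swapped_openers p j).
Proof.
move=> ji; have ltik := lt_ik; have [_ mono inc _ _] := L.
have in_kept x : x \in openers_with_label p j -> x \in kept.
  rewrite mem_openers_with_label mem_kept => /andP[/eqP Ex ->]; rewrite andbT.
  by apply/andP; split; apply/eqP => E; move: Ex;
     rewrite E ?red_opener_run ?red_closer_run; lia.
have facts x : x \in openers_with_label p j ->
  [/\ x < n.*2, rho x = j.*2, odd (rho (nth 0 p x)) & rho (nth 0 p x) < k.*2.-1].
  move=> xj; have [_ _ _ _ H] := kept_levels (in_kept _ xj).
  move: xj; rewrite mem_openers_with_label => /andP[/eqP Ex xn].
  have [_ _ _ -> _] := layering_partner L xn; rewrite Ex odd_double.
  by split=> //; apply: H; lia.
have block (P : pred nat) :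
  (forall x y, x \in openers_with_label p j -> y \in openers_with_label p j ->
      P x -> P y -> rho (nth 0 p x) < rho (nth 0 p y) ->
      g (rho (nth 0 p x)) < g (rho (nth 0 p y))) ->
  pairwise prec [seq x <- openers_with_label p j | P x].
  move=> H.
  have : pairwise ltn [seq x <- openers_with_label p j | P x].
    do 2!apply: pairwise_filter.
    by rewrite -(sorted_pairwise ltn_trans) iota_ltn_sorted.
  apply: sub_in_pairwise (allss _) => x y; rewrite !(mem_filter P).
  move=> /andP[Px xj] /andP[Py yj] lt.
  have [xn Ex _ _] := facts _ xj; have [yn Ey _ _] := facts _ yj.
  have Exy : rho x = rho y by rewrite Ex.
  have [pn _ _ _ _] := layering_partner L yn.
  have := mono _ _ (ltnW (inc _ _ lt yn Exy)) pn.
  rewrite /prec /precedes /= Exy ltnn eqxx leq_eqVlt /= => /orP[/eqP->|lt'].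
    by rewrite eqxx (lt : x < y) orbT.
  by rewrite H.
rewrite swapped_openersE pairwise_cat; apply/and3P; split.
- apply/allrelP => x y; rewrite [x \in _]mem_filter [y \in _]mem_filter.
  move=> /andP[Px xj] /andP[/eqP Ey yj].
  have [xn Ex ox ltx] := facts _ xj; have [yn Ey' _ _] := facts _ yj.
  rewrite /prec /precedes /= Ex Ey' ltnn eqxx Ey /=; apply/orP; left.
  by apply: contract_lt_moved => //; apply/eqP; lia.
- apply: block => x y xj yj Px Py lt.
  have [_ _ ox ltx] := facts _ xj; have [_ _ oy lty] := facts _ yj.
  by apply: contract_lt => //; lia.
- by apply: block => x y _ _ /eqP-> /eqP->; rewrite ltnn.
Qed.

(** Two points of different runs can only collide in the new last run; there the
moved closers come first, and rightly so, since their openers lie in runs before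
the removed one and the openers of the others lie after it. *)
Lemma rem3_order_sorted : pairwise prec (rem3_order p).
Proof.
have ltik := lt_ik; have [_ mono inc _ _] := L.
have Q : pairwise (fun x y => (sigma x \in kept) ==> (sigma y \in kept) ==>
    prec (sigma x) (sigma y)) (move_closers p).
  have := moved_order; apply: sub_in_pairwise (allss _) => x y.
  rewrite !(perm_mem perm_move_closers) !mem_points_lt => xn yn xy.
  have [sxn Rx] := swap_point_run xn; have [syn Ry] := swap_point_run yn.
  apply/implyP => xk; apply/implyP => yk.
  have [x1 x2 x3 x4 x5] := kept_levels xk; have [y1 y2 y3 y4 y5] := kept_levels yk.
  rewrite !Rx in x1 x2 x3 x4 x5; rewrite !Ry in y1 y2 y3 y4 y5.
  case/orP: xy => [lt|/andP[/eqP E lt]].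
    rewrite /prec /precedes /= Rx Ry.
    have [->//|[Ex Ey Eg]] := contract_rank ltik x1 y1 x2 y2 lt.
    rewrite /g Eg ltnn eqxx /=; apply/orP; left.
    by apply: contract_moved_lt; [|apply: x3|apply: y4].
  have [/andP[low ex]|H] := boolP ((rho x < i.*2) && ~~ odd (rho x)).
    have Ex : rho x = (rho x)./2.*2 by lia.
    set j := (rho x)./2 in Ex; have ji : j < i by rewrite /j; lia.
    rewrite !(@swap_point_nth _ j) // -?E //.
    have /(pairwiseP 0) := swapped_order ji; apply.
    - rewrite inE (perm_size (perm_swapped_openers j)) index_mem.
      by rewrite mem_openers_with_label Ex eqxx.
    - rewrite inE (perm_size (perm_swapped_openers j)) index_mem.
      by rewrite mem_openers_with_label -E Ex eqxx.
    have xj : x \in openers_with_label p j by rewrite mem_openers_with_label Ex eqxx.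
    have yj : y \in openers_with_label p j.
      by rewrite mem_openers_with_label -E Ex eqxx.
    have srt : sorted ltn (openers_with_label p j).
      by apply: sorted_filter; [exact: ltn_trans | exact: iota_ltn_sorted].
    rewrite ltnNge leq_eqVlt; apply/negP => /orP[/eqP Exy|].
      by move: lt; rewrite -(nth_index 0 xj) -Exy nth_index // ltnn.
    by move/(sorted_ltn_index ltn_trans srt _ _ yj xj); rewrite ltnNge ltnW.
  clear x3 x4 x5 y3 y4 y5.
  have Hy : ~~ ((rho y < i.*2) && ~~ odd (rho y)) by rewrite -E.
  rewrite !swap_point_id // in xk yk *.
  have [pn _ _ opy _] := layering_partner L yn.
  have [_ _ _ opx _] := layering_partner L xn.
  have := mono _ _ (ltnW (inc _ _ lt yn E)) pn.
  have [xpk _] := kept_partner xk; have [ypk _] := kept_partner yk.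
  have [_ xp _ _ _] := kept_levels xpk; have [_ yp _ _ _] := kept_levels ypk.
  rewrite /prec /precedes /= E ltnn eqxx leq_eqVlt /= => /orP[/eqP->|lt'].
    by rewrite eqxx (lt : x < y) orbT.
  apply/orP; left; have [_ _ _ _ lt1] := layering_partner L xn.
  have [_ _ plt _ _] := layering_partner L pn.
  apply: contract_lt => // Epx; move: Hy; rewrite -E.
  have opx' : odd (rho x) = false by move: opx; rewrite Epx /= odd_double; case: odd.
  rewrite opx' andbT -leqNgt => le; move: lt1; rewrite opx' Epx.
  by move: opx'; clear -le x2; lia.
have : pairwise (fun x y => (x \in kept) ==> (y \in kept) ==> prec x y)
    (rem3_order p).
  by rewrite rem3_orderE; apply: pairwise_filter; rewrite pairwise_map.
apply: sub_in_pairwise (allss _) => x y.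
by rewrite !(perm_mem perm_rem3_order) => -> ->.
Qed.

Lemma step_rem3 :
  [/\ stoimenow n.-1 (renumber p (rem3_order p)),
      dim (renumber p (rem3_order p)) = reduce_dim k M
    & perm_eq (cells (renumber p (rem3_order p))) (reduce k M)].
Proof.
have ltik := lt_ik.
apply: (@renumber_step g) => //.
- exact: perm_rem3_order.
- exact: contract_odd.
- exact: rem3_order_sorted.
- move=> x y xk yk; have [x1 x2 x3 x4 x5] := kept_levels xk.
  have [y1 y2 y3 y4 y5] := kept_levels yk.
  case/(contract_eq ltik x1 y1 x2 y2) => // [[Ex Ey]|[Ex Ey]].
    by have := contract_moved_lt ltik (x3 Ex) (y4 Ey); rewrite /g; lia.
  by have := contract_moved_lt ltik (y3 Ey) (x4 Ex); rewrite /g; lia.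
rewrite /reduce -/i -/M lone (negbTE ik) /=.
rewrite -(permPr (perm_map _ (cells_kept perm_rem3_order))).
rewrite /token_cells -map_comp; apply/permP => P; congr count.
rewrite (@eq_in_filter _ _ (fun x => ~~ odd (rho x))); last first.
  by move=> x; rewrite (perm_mem perm_rem3_order) /= => /contract_odd->.
apply/eq_in_map => x; rewrite mem_filter (perm_mem perm_rem3_order).
move=> /andP[ex xk] /=.
have [x1 x2 x3 x4 x5] := kept_levels xk.
have [xpk _] := kept_partner xk; have [_ xp _ _ _] := kept_levels xpk.
have opx : odd (rho (nth 0 p x)).
  move: xk; rewrite mem_kept => /and3P[_ _ xn].
  by have [_ _ _ -> _] := layering_partner L xn.
exact: contract_run_half.
Qed.

End Rem3.

End PsiStep.

(** * Bijectivity of the removal operation *)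

Lemma psiP n p : 1 < n -> stoimenow n p ->
  [/\ (psi p).2 = top_row (dim p) (cells p), stoimenow n.-1 (psi p).1,
      dim (psi p).1 = reduce_dim (dim p) (cells p)
    & perm_eq (cells (psi p).1) (reduce (dim p) (cells p))].
Proof.
move=> n1 st; rewrite /psi /= (red_labelE n1 st).
rewrite (size_arcs_with_label n1 st) (max_labelE n1 st).
case: (boolP (1 < _)) => w; first by have [] := step_simple n1 st ltac:(by rewrite w).
have lone := negbTE w.
case: eqVneq => ik.
  rewrite (maxarc_redarc n1 st lone ik).
  by have [] := step_simple n1 st ltac:(by rewrite -ik eqxx orbT).
by have [] := step_rem3 n1 st lone ik.
Qed.

Lemma stoimenow_fishburn n p : 0 < n -> stoimenow n p -> fishburn (dim p) (cells p).
Proof. by move=> n0 st; apply: layering_fishburn (stoimenow_layering n0 st). Qed.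

Lemma size_cells n p : 0 < n -> stoimenow n p -> size (cells p) = n.
Proof. by move=> n0 st; apply: size_cells_of (stoimenow_layering n0 st). Qed.

Lemma cells_inj n p q : 0 < n -> stoimenow n p -> stoimenow n q ->
  perm_eq (cells p) (cells q) -> p = q.
Proof.
move=> n0 stp stq.
exact: layering_inj (stoimenow_layering n0 stp) (stoimenow_layering n0 stq).
Qed.

Lemma cells_surj k M : 0 < size M -> fishburn k M ->
  exists p, [/\ stoimenow (size M) p, dim p = k & perm_eq (cells p) M].
Proof.
move=> M0 /layering_exists[p [rho [L E]]]; exists p.
by have [? ? ->] := layering_stoimenow M0 L.
Qed.

Lemma psi_inj n p q : 1 < n -> stoimenow n p -> stoimenow n q -> psi p = psi q -> p = q.
Proof.
move=> n1 stp stq E; have n0 : 0 < n by lia.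
have [ip _ dp cp] := psiP n1 stp; have [iq _ dq cq] := psiP n1 stq.
apply: (cells_inj n0 stp stq).
rewrite (permPl (extend_reduce (stoimenow_fishburn n0 stp) _ _)) //;
  last by rewrite (size_cells n0 stp).
rewrite perm_sym (permPl (extend_reduce (stoimenow_fishburn n0 stq) _ _)) //;
  last by rewrite (size_cells n0 stq).
rewrite -ip -dp -iq -dq E; apply: perm_extend.
by rewrite -(permPl cq) -(permPr cp) E.
Qed.

Lemma psi_surj n q i : 0 < n -> stoimenow n q -> i <= dim q ->
  exists2 p, stoimenow n.+1 p & psi p = (q, i).
Proof.
move=> n0 stq iq; have Fq := stoimenow_fishburn n0 stq.
have sM : size (extend (dim q) (cells q) i) = n.+1.
  rewrite /extend; case: ifP => _; [|case: ifP => _];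
    by rewrite /= ?(size_map (expand _ _)) (size_cells n0 stq).
have d0 : 0 < dim q by rewrite /dim.
have [|p [stp dp cp]] := cells_surj _ (fishburn_extend Fq d0 iq); first by rewrite sM.
rewrite sM in stp.
exists p => //; have n1 : 1 < n.+1 by lia.
have [ip st _ c] := psiP n1 stp.
rewrite [psi p]surjective_pairing ip dp (perm_top_row _ cp) top_row_extend //.
congr pair.
apply: (cells_inj n0 st stq); rewrite (permPl c) dp.
by rewrite (permPl (perm_reduce _ cp)) reduce_extend.
Qed.

(** * Ascent sequences *)

Lemma asc_rcons x i : 0 < size x -> asc (rcons x i) = asc x + (last 0 x < i).
Proof.
case/lastP: x => // x a _; rewrite /asc !size_rcons last_rcons !succnK.
rewrite iota_rcons -[rcons (iota _ _) _]cats1 count_cat /= addn0; congr (_ + _).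
  apply: eq_in_count => j; rewrite mem_iota => jx.
  by rewrite [in LHS]nth_rcons [X in _ < X]nth_rcons size_rcons !ifT //; lia.
by rewrite !nth_rcons size_rcons ltnSn ltnn eqxx ltnn eqxx.
Qed.

Lemma ascent_sequence_rcons n x i : 0 < n ->
  ascent_sequence n.+1 (rcons x i) <-> ascent_sequence n x /\ i <= 1 + asc x.
Proof.
move=> n0; have H y j : size y = n -> j < n -> nth 0 (rcons y i) j = nth 0 y j.
  by move=> sy jn; rewrite nth_rcons sy jn.
split=> [[/eqP]|[[sx x0 xs] ix]].
  rewrite size_rcons eqSS => /eqP sx x0 xs; split.
    split=> //; first by rewrite H in x0.
    move=> j /andP[j0 jn]; have := xs j.
    rewrite H // j0 ltnW //= -cats1 takel_cat ?sx //.
      by apply.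
    exact: ltnW.
  have := xs n; rewrite n0 ltnSn nth_rcons sx ltnn eqxx.
  by rewrite -cats1 -sx take_size_cat //; apply.
split; first by rewrite size_rcons sx.
  by rewrite H.
move=> j /andP[j0]; rewrite ltnS leq_eqVlt => /orP[/eqP->|jn].
  by rewrite nth_rcons sx ltnn eqxx -cats1 -sx take_size_cat.
rewrite H // -cats1 takel_cat ?sx; last exact: ltnW.
by apply: xs; rewrite j0.
Qed.

Lemma PsiS n p : 0 < n -> Psi n.+1 p = rcons (Psi n (psi p).1) (psi p).2.
Proof. by case: n => // n _; rewrite [LHS]/=; case: psi. Qed.

Lemma stoimenow1 p : stoimenow 1 p -> p = [:: 1; 0].
Proof.
case=> -[sp H] _ _; case: p sp H => [|a [|b []]] //= _ H.
have [/= a2 a0 _] := H 0 isT; have [/= b2 b1 _] := H 1 isT.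
by congr [:: _; _]; lia.
Qed.

Lemma stoimenow1_ex : stoimenow 1 [:: 1; 0].
Proof.
split.
- by split=> // -[|[|]].
- by move=> [a [b [k [/and3P[/= ? ? _] /and3P[/= ? ? _] _]]]]; lia.
- by move=> [a [b [k [/and3P[/= ? ? _] /and3P[/= ? ? _] _]]]]; lia.
Qed.

(** By [top_row_reduce], the dimension grows exactly when an ascent is appended. *)
Lemma Psi_ascent n p : 0 < n -> stoimenow n p ->
  [/\ ascent_sequence n (Psi n p), (asc (Psi n p)).+1 = dim p
    & last 0 (Psi n p) = top_row (dim p) (cells p)].
Proof.
case: n => // n _; elim: n p => [|n IH] p st.
  rewrite (stoimenow1 st); split=> //.
  by split=> // -[|k] //; rewrite ltnS ltn0 andbF.
have n1 : 1 < n.+2 by lia.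
have [ip stq dq cq] := psiP n1 st; have [aq Eq lq] := IH _ stq.
have Fp := stoimenow_fishburn (ltnW n1) st.
have [] := top_row_reduce Fp (ltn0Sn _); first by rewrite (size_cells (ltnW n1) st).
rewrite -dq -(perm_top_row _ cq) -ip -lq => E1 E2.
have [sq _ _] := aq.
rewrite PsiS // asc_rcons ?sq // last_rcons; split=> //.
  by apply/ascent_sequence_rcons => //; rewrite add1n Eq.
by rewrite -E1 -Eq addSn.
Qed.

Theorem theorem7 (n : nat) (hn : 1 <= n) :
  [/\ forall p : seq nat, stoimenow n p -> ascent_sequence n (Psi n p),
      forall p q : seq nat, stoimenow n p -> stoimenow n q ->
        Psi n p = Psi n q -> p = q
    & forall x : seq nat, ascent_sequence n x ->
        exists2 p : seq nat, stoimenow n p & Psi n p = x].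
Proof.
split.
- by move=> p /(Psi_ascent hn)[].
- case: n hn => // n _; elim: n => [|n IH] p q stp stq.
    by rewrite (stoimenow1 stp) (stoimenow1 stq).
  have n1 : 1 < n.+2 by [].
  rewrite (PsiS p (ltn0Sn n)) (PsiS q (ltn0Sn n)) => /rcons_inj E.
  have E1 : Psi n.+1 (psi p).1 = Psi n.+1 (psi q).1 by case: E.
  have E2 : (psi p).2 = (psi q).2 by case: E.
  apply: (psi_inj n1) => //.
  have [_ stp' _ _] := psiP n1 stp; have [_ stq' _ _] := psiP n1 stq.
  rewrite [psi p]surjective_pairing [psi q]surjective_pairing.
  by rewrite E2 (IH _ _ stp' stq' E1).
- case: n hn => // n _; elim: n => [|n IH] x.
    case=> sx x0 _; exists [:: 1; 0]; first exact: stoimenow1_ex.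
    by case: x sx x0 => [|a []] //= _ ->.
  case/lastP: x => [[]//|x i] /ascent_sequence_rcons[] // ax ix.
  have [q stq Eq] := IH _ ax.
  have [_ dq _] := Psi_ascent (ltn0Sn n) stq.
  have [p stp Ep] : exists2 p, stoimenow n.+2 p & psi p = (q, i).
    by apply: psi_surj => //; rewrite -dq Eq.
  by exists p; rewrite // (PsiS p (ltn0Sn n)) Ep Eq.
Qed.
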